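(* Every connected claw-free subcubic graph, except the graph $\mathcal{H}$ (i.e. not isomorphic to $\mathcal{H}$), is $(1,1,3,3,3)$-packing colorable.
   Context: All graphs are finite and simple. A graph is subcubic if its maximum degree is at most $3$, and claw-free if it has no induced subgraph isomorphic to $K_{1,3}$. For a non-decreasing sequence $S=(a_1,\ldots,a_r)$ of positive integers, an $S$-packing coloring of a graph $G$ is a partition of $V(G)$ into (possibly empty) sets $A_1,\ldots,A_r$ such that, for every $i\in\{1,\ldots,r\}$, any two distinct vertices in $A_i$ are at distance greater than $a_i$ in $G$. $G$ is $S$-packing colorable if it has an $S$-packing coloring. The graph $\mathcal{H}$ has vertex set $\{1,\ldots,12\}$ and edges $12, 23, 34, 45, 56, 67, 78, 81$ (an $8$-cycle $1,2,\ldots,8$), together with $\{1,9\},\{2,9\},\{3,10\},\{4,10\},\{5,11\},\{6,11\},\{7,12\},\{8,12\},\{9,11\},\{10,12\}$. (It is $K_4$ with every vertex replaced by a triangle.) *)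

(* Defs.v *)
From mathcomp Require Import all_boot.

Set Implicit Arguments.
Unset Strict Implicit.
Unset Printing Implicit Defensive.

Record sgraph := SGraph {
  vertex :> finType;
  adj : rel vertex;
  adj_sym : symmetric adj;
  adj_irrefl : irreflexive adj
}.

Definition isomorphic (G H : sgraph) : Prop :=
  exists f : G -> H, bijective f /\ forall x y : G, adj x y = adj (f x) (f y).

Definition has_induced (G F : sgraph) : Prop :=
  exists f : F -> G, injective f /\ forall x y : F, adj x y = adj (f x) (f y).

(* This allows the graph without vertices. *)
Definition connected (G : sgraph) : Prop :=
  forall x y : G, connect (@adj G) x y.

Definition degree (G : sgraph) (x : G) : nat := #|[set y | adj x y]|.

Definition max_degree (G : sgraph) : nat := \max_(x : G) degree x.

Definition subcubic (G : sgraph) : Prop := max_degree G <= 3.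

Definition K13_adj : rel 'I_4 := fun i j => (i == ord0) != (j == ord0).

Lemma K13_adj_sym : symmetric K13_adj.
Proof. by move=> i j; rewrite /K13_adj eq_sym. Qed.

Lemma K13_adj_irrefl : irreflexive K13_adj.
Proof. by move=> i; rewrite /K13_adj eqxx. Qed.

Definition K13 : sgraph := SGraph K13_adj_sym K13_adj_irrefl.

Definition claw_free (G : sgraph) : Prop := ~ has_induced G K13.

(* For x and y in different components no d satisfies [is_dist x y d]: their
   distance is infinite. *)
Definition is_dist (G : sgraph) (x y : G) (d : nat) : Prop :=
  (exists p : seq G, [/\ path (@adj G) x p, last x p = y & size p = d]) /\
  (forall p : seq G, path (@adj G) x p -> last x p = y -> d <= size p).

Definition dist_gt (G : sgraph) (x y : G) (a : nat) : Prop :=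
  forall d : nat, is_dist x y d -> a < d.

(* The sets A i are indexed from 0, and some of them may be empty. *)
Definition packing_coloring (r : nat) (S : r.-tuple nat) (G : sgraph)
    (A : 'I_r -> {set G}) : Prop :=
  (forall x : G, exists! i : 'I_r, x \in A i) /\
  (forall (i : 'I_r) (x y : G),
     x \in A i -> y \in A i -> x <> y -> dist_gt x y (tnth S i)).

Definition packing_colorable (r : nat) (S : r.-tuple nat) (G : sgraph) : Prop :=
  exists A : 'I_r -> {set G}, packing_coloring S A.

Definition graphH_edges : seq (nat * nat) :=
  [:: (1, 2); (2, 3); (3, 4); (4, 5); (5, 6); (6, 7); (7, 8); (8, 1);
      (1, 9); (2, 9); (3, 10); (4, 10); (5, 11); (6, 11); (7, 12); (8, 12);
      (9, 11); (10, 12)].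

(* The ordinal i : 'I_12 stands for the vertex i + 1 of {1, ..., 12}. *)
Definition graphH_adj : rel 'I_12 := fun i j =>
  ((i.+1, j.+1) \in graphH_edges) || ((j.+1, i.+1) \in graphH_edges).

Lemma graphH_adj_sym : symmetric graphH_adj.
Proof. by move=> i j; rewrite /graphH_adj orbC. Qed.

Lemma graphH_adj_irrefl : irreflexive graphH_adj.
Proof. by case; do 12![case=> [|] //]. Qed.

Definition graphH : sgraph := SGraph graphH_adj_sym graphH_adj_irrefl.

(* Main.v *)
Require Import Defs.
From mathcomp Require Import all_boot.
From mathcomp Require Import perm.
From Stdlib Require Import Classical.

Set Implicit Arguments.
Unset Strict Implicit.
Unset Printing Implicit Defensive.

(** A triangular edge lies in a triangle ([tri]); the other edges are bare.
    Outside K4, claw-freeness and maximum degree 3 leave two kinds of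
    vertices: those in no triangle, of degree at most 2, and those whose
    triangular edges form a triangle or a diamond (K4 minus an edge).  A
    vertex of the second kind has at most one bare edge, and the two middle
    vertices of a diamond have none.

    One vertex is picked in each triangle and one middle vertex in each diamond
    ([perfect]).  This destroys all triangles, and every remaining vertex has at
    most two remaining neighbours.  The picks are to receive the three colours
    with distances greater than 3, and the rest is to be 2-coloured.

    Colouring the picks.  Let the picks be [separated]: no two of them have bare
    edges to one and the same triangle.  Two picks at distance at most 3 then
    lie in components joined by a link, that is, a bare edge or a path with one
    or two inner vertices, all in no triangle ([near_link]).  A component has at
    most three ends of links, so every pick conflicts with at most three others
    ([conflict_degree]), and Brooks' theorem ([brooks_set]) gives three colours
    unless four picks conflict pairwise.  Separated picks exist by Hall's
    theorem ([exists_perfect_separated]): the triangles with three bare edges to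
    triangles must choose among them, and each triangle receives at most three
    such edges.

    Four pairwise conflicting picks.  Their components are four triangles, any
    two of them linked, and together with the links they fill the graph
    ([clique_quartet]).  If all the links are bare edges, the graph is [graphH]
    ([quartet_graphH]); if one of them is longer, explicit new picks work
    ([quartet_long_link]).

    Colouring the rest.  A minimal non-bipartite set [K] of remaining vertices
    has minimum degree 2 and is connected.  Call a vertex plain if it lies in a
    triangle outside the diamonds.  If all of [K] is plain, triangular and bare
    edges form two perfect matchings of [K], so [K] is bipartite
    ([plain_core_bip]).  If [K] has plain and other vertices, an edge of [K]
    joins a plain [u] to a vertex that is not plain; moving the pick of the
    triangle of [u] to [u] keeps the picks separated and lowers the number of
    sets of minimum degree 2 among the remaining vertices ([shift]), so it is
    enough to minimise this number.  If no vertex of [K] is plain, the graph is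
    a cycle or a ring of diamonds and paths, and the removal of one more vertex
    that conflicts with at most two picks makes the rest bipartite
    ([necklace]). *)

(** * Hall's marriage theorem *)

Section Hall.
Variables (I T : finType).

(** If some proper nonempty [S] has only [#|S|] neighbours, then Hall's condition
    holds for [S] and also for the rest of [X] outside the neighbours of [S].
    If there is no such [S], the condition has enough slack to match one element
    of [X] arbitrarily. *)
Lemma hall (t0 : T) (N : I -> {set T}) (X : {set I}) :
  (forall S : {set I}, S \subset X -> #|S| <= #|\bigcup_(i in S) N i|) ->
  exists f : I -> T, {in X &, injective f} /\ {in X, forall i, f i \in N i}.
Proof.
have [n] := ubnP #|X|; elim: n => // n IHn in X N *; rewrite ltnS => leXn hallX.
have [->|[i0 Xi0]] := set_0Vmem X.
  by exists (fun _ => t0); split=> [i j|i]; rewrite inE.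
have [[S [sSX S0 SX leS]]|tight] := classic (exists S : {set I},
    [/\ S \subset X, S != set0, S != X & #|\bigcup_(i in S) N i| <= #|S|]).
- have pSX : S \proper X by rewrite properEneq SX.
  have [||f [finj fN]] := IHn S N; first exact: leq_trans (proper_card pSX) leXn.
    by move=> U sUS; apply: hallX; apply: subset_trans sSX.
  set W := \bigcup_(i in S) N i in leS.
  have [||g [ginj gN]] := IHn (X :\: S) (fun i => N i :\: W).
  + apply: leq_trans leXn; apply: proper_card; rewrite properE subsetDl /=.
    have /set0Pn[s Ss] := S0; apply/subsetPn; exists s; first exact: (subsetP sSX).
    by rewrite inE Ss.
  + move=> U sU.
    have US0 : U :&: S = set0.
      apply/setP=> i; rewrite !inE; apply/negP=> /andP[/(subsetP sU)].
      by rewrite inE => /andP[/negP].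
    have := hallX (U :|: S); rewrite subUset sSX (subset_trans sU) ?subsetDl //.
    rewrite cardsU US0 cards0 subn0 => /(_ isT).
    have -> : \bigcup_(i in U :|: S) N i = (\bigcup_(i in U) (N i :\: W)) :|: W.
      rewrite bigcup_setU -/W; apply/setP=> x; rewrite !inE.
      case xW: (x \in W); rewrite ?orbT ?orbF //.
      apply/bigcupP/bigcupP=> -[i Ui Nx]; exists i => //; last by move: Nx; rewrite inE xW.
      by rewrite inE xW.
    move=> le1; rewrite -(leq_add2r #|S|); apply: leq_trans le1 _.
    by apply: leq_trans (leq_card_setU _ _).1 _; rewrite leq_add2l.
  exists (fun i => if i \in S then f i else g i); split=> [i j Xi Xj|i Xi].
    have NW i' : i' \in S -> f i' \in W.
      by move=> Si'; apply/bigcupP; exists i' => //; exact: fN.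
    case: ifP => Si; case: ifP => Sj; first exact: finj.
    + move=> E; have := gN j; rewrite !inE Xj Sj => /(_ isT)/andP[].
      by rewrite -E NW.
    + move=> E; have := gN i; rewrite !inE Xi Si => /(_ isT)/andP[].
      by rewrite E NW.
    by apply: ginj; rewrite inE ?Si ?Sj.
  case: ifP => Si; first exact: fN.
  by have := gN i; rewrite !inE Si Xi => /(_ isT)/andP[].
- have [t Nt] : exists t, t \in N i0.
    apply/set0Pn; rewrite -card_gt0.
    by have := hallX [set i0]; rewrite cards1 big_set1 sub1set; apply.
  have [||f [finj fN]] := IHn (X :\ i0) (fun i => N i :\ t).
  + by apply: leq_trans leXn; rewrite [X in _ < X](cardsD1 i0) Xi0.
  + move=> S sS; have [->|[s Ss]] := set_0Vmem S; first by rewrite cards0.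
    have sSX : S \subset X := subset_trans sS (subsetDl _ _).
    have : #|S| < #|\bigcup_(i in S) N i|.
      rewrite ltnNge; apply/negP=> le; apply: tight; exists S; split=> //.
        by apply/set0Pn; exists s.
      by apply: contraTneq sS => ->; apply/subsetPn; exists i0; rewrite // !inE eqxx.
    have -> : \bigcup_(i in S) (N i :\ t) = (\bigcup_(i in S) N i) :\ t.
      apply/setP=> x; rewrite !inE; apply/bigcupP/andP=> [[i Si]|[xt /bigcupP[i Si Nx]]].
        by rewrite !inE => /andP[-> Nx]; split=> //; apply/bigcupP; exists i.
      by exists i; rewrite // !inE xt.
    rewrite (cardsD1 t (\bigcup_(i in S) N i)).
    by case: (t \in _); rewrite ?ltnS // add0n; apply: ltnW.
  exists (fun i => if i == i0 then t else f i); split=> [i j Xi Xj|i Xi].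
    case: eqP => [->|/eqP ii0]; case: eqP => [->|/eqP ji0] //.
    + by move=> E; have := fN j; rewrite !inE ji0 Xj -E eqxx => /(_ isT).
    + by move=> E; have := fN i; rewrite !inE ii0 Xi E eqxx => /(_ isT).
    by apply: finj; rewrite !inE ?ii0 ?ji0.
  case: eqP => [->|/eqP ii0] //.
  by have := fN i; rewrite !inE ii0 Xi => /(_ isT)/andP[].
Qed.
End Hall.

(** * Bipartite sets of vertices *)

Section Bipartite.
Variables (T : finType) (e : rel T).
Hypothesis (e_sym : symmetric e) (eirr : irreflexive e).

Lemma handshake (A : {set T}) :
  ~~ odd (\sum_(x in A) #|[set y in A | e x y]|).
Proof.
rewrite (eq_bigr (fun x => \sum_(y in A) (e x y : nat))); last first.
  by move=> x _; rewrite -sum1dep_card big_mkcondr.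
have [n] := ubnP #|A|; elim: n => // n IHn in A *; rewrite ltnS => leAn.
have [->|[a Aa]] := set_0Vmem A; first by rewrite big_set0.
have aB : a \notin A :\ a by rewrite !inE eqxx.
rewrite -(setD1K Aa) big_setU1 //= big_setU1 //= eirr add0n.
under [X in _ + X]eq_bigr => x _ do rewrite big_setU1 //= e_sym.
rewrite big_split /= addnA addnn oddD odd_double /= IHn //.
by move: leAn; rewrite (cardsD1 a A) Aa.
Qed.

Definition bipartite_on (S : {set T}) :=
  exists f : T -> bool, {in S &, forall x y, e x y -> f x != f y}.

Lemma min_nonbip (S : {set T}) : ~ bipartite_on S ->
  exists K : {set T}, [/\ K \subset S, ~ bipartite_on K &
    forall K' : {set T}, K' \proper K -> bipartite_on K'].
Proof.
have [n] := ubnP #|S|; elim: n => // n IHn in S *; rewrite ltnS => leSn nbS.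
have [[K' [pK nbK]]|min] := classic (exists K' : {set T}, K' \proper S /\ ~ bipartite_on K').
  have [|K [sK nK mK]] := IHn K' _ nbK; first exact: leq_trans (proper_card pK) leSn.
  by exists K; split=> //; apply: subset_trans (proper_sub pK).
exists S; split=> // K' pK; apply: NNPP => nbK; apply: min; by exists K'.
Qed.

(** A cycle has minimum degree 2, and where all degrees are at most 2 a set of
    minimum degree 2 is a union of cycles.  These sets replace cycles throughout,
    since they can be counted and intersected without choosing walks. *)
Definition min_degree2 (S : {set T}) :=
  [forall v in S, 1 < #|[set y in S | e v y]|].

(** A vertex with at most one neighbour in [K] could be coloured last. *)
Lemma min_nonbip_mindeg2 (K : {set T}) : ~ bipartite_on K ->
  (forall K' : {set T}, K' \proper K -> bipartite_on K') -> min_degree2 K.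
Proof.
move=> nbK minK; apply/forall_inP=> v Kv; rewrite ltnNge; apply/negP=> le1.
have [f fP] := minK _ (properD1 Kv).
have [b bP] : exists b, forall y, y \in K -> e v y -> b != f y.
  have [E|[u]] := set_0Vmem [set y in K | e v y].
    by exists true => y Ky evy; move/setP/(_ y): E; rewrite !inE Ky evy /=.
  move=> uN; exists (~~ f u) => y Ky evy.
  have -> : y = u by apply: (card_le1_eqP le1) => //; rewrite inE Ky.
  by case: (f u).
apply: nbK; exists (fun x => if x == v then b else f x) => x y Kx Ky exy.
case: (eqVneq x v) => [xv|xv]; case: (eqVneq y v) => [yv|yv].
- by move: exy; rewrite xv yv eirr.
- by apply: bP => //; rewrite -xv.
- by rewrite eq_sym; apply: bP => //; rewrite -yv e_sym.
- by apply: fP => //; rewrite !inE ?xv ?yv.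
Qed.

(** Colourings of two parts without edges between them can be glued. *)
Lemma min_nonbip_connected (K A : {set T}) : ~ bipartite_on K ->
  (forall K' : {set T}, K' \proper K -> bipartite_on K') -> A \subset K ->
  (forall x y, x \in A -> y \in K -> y \notin A -> ~~ e x y) ->
  A = set0 \/ A = K.
Proof.
move=> nbK minK sAK sep; apply: NNPP => /not_or_and[/eqP A0 /eqP AK].
have [f fP] : bipartite_on A by apply: minK; rewrite properEneq AK.
have [g gP] : bipartite_on (K :\: A).
  apply: minK; rewrite properE subsetDl; have /set0Pn[a Aa] := A0.
  by apply/subsetPn; exists a; [exact: (subsetP sAK) | rewrite inE Aa].
apply: nbK; exists (fun x => if x \in A then f x else g x) => x y Kx Ky exy.
case: ifP => Ax; case: ifP => Ay; first exact: fP.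
- by have := sep x y Ax Ky (negbT Ay); rewrite exy.
- by have := sep y x Ay Kx (negbT Ax); rewrite e_sym exy.
- by apply: gP; rewrite // inE ?Ax ?Ay.
Qed.

(** The union of two perfect matchings is bipartite.  With [g := s \o t], the
    involution [s] maps each orbit of [g] onto another orbit, and [t x] lies in
    the orbit of [s x]; so the two orbits of such a pair are the two colour
    classes of their union.  An orbit is not mapped to itself because
    [g ^ k.+2 x = s x] implies [g ^ k (g x) = s (g x)], and this descent ends at
    a fixed point of [s] or [t]. *)
Lemma two_involutions (K : {set T}) (s0 t0 : T -> T) :
  {in K, forall x, [/\ s0 x \in K, s0 (s0 x) = x & s0 x != x]} ->
  {in K, forall x, [/\ t0 x \in K, t0 (t0 x) = x & t0 x != x]} ->
  exists f : T -> bool, {in K, forall x, f (s0 x) != f x /\ f (t0 x) != f x}.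
Proof.
move=> hs0 ht0.
pose s x := if x \in K then s0 x else x; pose t x := if x \in K then t0 x else x.
have ss : involutive s.
  move=> x; rewrite /s; case Kx: (x \in K); last by rewrite Kx.
  by have [-> -> _] := hs0 x Kx.
have tt : involutive t.
  move=> x; rewrite /t; case Kx: (x \in K); last by rewrite Kx.
  by have [-> -> _] := ht0 x Kx.
have Ks x : x \in K -> s x \in K by move=> Kx; rewrite /s Kx; have [] := hs0 x Kx.
have Kt x : x \in K -> t x \in K by move=> Kx; rewrite /t Kx; have [] := ht0 x Kx.
have sx x : x \in K -> s x <> x by move=> Kx; rewrite /s Kx; apply/eqP; have [] := hs0 x Kx.
have tx x : x \in K -> t x <> x by move=> Kx; rewrite /t Kx; apply/eqP; have [] := ht0 x Kx.
pose g x := s (t x).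
have ginj : injective g by move=> x y /(inv_inj ss)/(inv_inj tt).
have Kg x : x \in K -> g x \in K by move=> Kx; apply/Ks/Kt.
(* the descent from k.+2 to k *)
have nog k x : x \in K -> iter k g x <> s x.
  have [n] := ubnP k; elim: n => // n IHn in k x * => + Kx.
  case: k => [_ E|[_ /(inv_inj ss) E|k ltkn E]]; [exact: (sx x)|exact: (tx x)|].
  apply: (IHn k (g x)); [exact: ltnW | exact: Kg | rewrite -iterSr].
  by apply: ginj; rewrite -iterS E /g ss tt.
have symg := fconnect_sym ginj.
have sg x : fconnect g (s x) (s (g x)).
  rewrite symg; have -> : s x = g (s (g x)) by rewrite /g ss tt.
  exact: fconnect1.
pose r := froot g.
have rE x y : (r x == r y) = fconnect g x y by rewrite /r root_connect.
have rsg x y : r x = r y -> r (s x) = r (s y).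
  move/eqP; rewrite rE => /iter_findex <-; elim: (findex g x y) => //= n ->.
  by apply/eqP; rewrite rE.
have rs x : x \in K -> r x != r (s x).
  by move=> Kx; rewrite rE; apply/negP=> /iter_findex/nog; apply.
exists (fun x => enum_rank (r x) < enum_rank (r (s x))) => x Kx.
have main : (enum_rank (r (s x)) < enum_rank (r x)) !=
            (enum_rank (r x) < enum_rank (r (s x))).
  have : val (enum_rank (r x)) != val (enum_rank (r (s x))).
    by apply: contra (rs x Kx) => /eqP/val_inj/enum_rank_inj->.
  by case: ltngtP.
have -> : s0 x = s x by rewrite /s Kx.
have -> : t0 x = t x by rewrite /t Kx.
split; first by rewrite ss.
have -> : r (t x) = r (s x).
  have -> : t x = s (g x) by rewrite /g ss.
  by apply/rsg/eqP; rewrite rE symg fconnect1.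
by rewrite (_ : r (s (t x)) = r x) //; apply/eqP; rewrite rE symg fconnect1.
Qed.
End Bipartite.

(** * Brooks' theorem for three colours *)

Section Brooks.
Variables (T : finType) (e : rel T).
Hypothesis (e_sym : symmetric e) (e_irr : irreflexive e).
Hypothesis deg3 : forall x, #|[set y | e x y]| <= 3.

Definition proper_on (A : {set T}) (c : T -> 'I_3) :=
  {in A &, forall x y, e x y -> c x != c y}.

Lemma free_color (A : {set 'I_3}) : #|A| < 3 -> exists k, k \notin A.
Proof.
move=> ltA; have /subsetPn[k _ nA] : ~~ ([set: 'I_3] \subset A).
  by apply/negP=> /subset_leq_card; rewrite cardsT card_ord leqNgt ltA.
by exists k.
Qed.

Lemma extend_color (A : {set T}) (c : T -> 'I_3) v : proper_on A c -> v \notin A ->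
  #|c @: [set y in A | e v y]| < 3 ->
  exists c', {in A, c' =1 c} /\ proper_on (v |: A) c'.
Proof.
move=> cP vA /free_color[k kN].
have kP y : y \in A -> e v y -> k != c y.
  by move=> Ay evy; apply: contraNneq kN => ->; rewrite imset_f // inE Ay.
have nv y : y \in A -> (y == v) = false by move=> Ay; apply: contraNF vA => /eqP<-.
exists (fun x => if x == v then k else c x); split=> [x Ax|]; first by rewrite nv.
move=> x y /setU1P[->|Ax] /setU1P[->|Ay]; rewrite ?eqxx ?e_irr ?nv //.
- exact: kP.
- by rewrite eq_sym e_sym; apply: kP.
- exact: cP.
Qed.

(** The two lemmas below are the two ways in which only two colours are forbidden
    for a vertex of degree 3: an uncoloured neighbour, or two neighbours of the
    same colour. *)
Lemma extend_uncolored_nbr (A : {set T}) (c : T -> 'I_3) v w :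
  proper_on A c -> v \notin A -> w \notin A -> e v w ->
  exists c', {in A, c' =1 c} /\ proper_on (v |: A) c'.
Proof.
move=> cP vA wA evw; apply: extend_color => //.
apply: leq_ltn_trans (leq_imset_card _ _) _; apply: leq_trans (deg3 v).
apply: proper_card; apply/properP; split.
  by apply/subsetP=> y; rewrite !inE => /andP[].
by exists w; rewrite !inE ?(negPf wA).
Qed.

Lemma extend_same_color (A : {set T}) (c : T -> 'I_3) v x y :
  proper_on A c -> v \notin A -> e v x -> e v y -> x \in A -> x != y -> c x = c y ->
  exists c', {in A, c' =1 c} /\ proper_on (v |: A) c'.
Proof.
move=> cP vA evx evy Ax xy cxy; apply: extend_color => //.
set N := [set z in A | e v z].
have sN : c @: N \subset c @: ([set z | e v z] :\ x).
  apply/subsetP=> _ /imsetP[z Nz ->]; move: Nz; rewrite inE => /andP[Az evz].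
  have [->|zx] := eqVneq z x; last by rewrite imset_f // !inE zx.
  by rewrite cxy imset_f // !inE eq_sym xy.
apply: leq_ltn_trans (subset_leq_card sN) _.
apply: leq_ltn_trans (leq_imset_card _ _) _; apply: leq_trans (deg3 v).
by rewrite [X in _ < X](cardsD1 x) inE evx.
Qed.

(** Along a path each vertex is coloured while its successor is still uncoloured;
    only the last vertex [z] has to be left out. *)
Lemma greedy (q : seq T) z (A : {set T}) c : proper_on A c ->
  sorted e (rcons q z) -> uniq (rcons q z) -> {in rcons q z, forall x, x \notin A} ->
  exists c', {in A, c' =1 c} /\ proper_on (A :|: [set x in q]) c'.
Proof.
elim: q A c => [|x q IHq] A c /= cP.
  by exists c; split=> // x y; rewrite !inE !orbF; apply: cP.
move=> pq /andP[xq uq] dA.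
have xA : x \notin A by apply: dA; rewrite inE eqxx.
have [w [wq exw]] : exists w, w \in rcons q z /\ e x w.
  by case: q pq {IHq xq uq dA} => [|w q] /= /andP[exw _]; [exists z|exists w]; rewrite !inE eqxx.
have [|c1 [c1A c1P]] := extend_uncolored_nbr cP xA _ exw.
  by apply: dA; rewrite inE wq orbT.
have [||c2 [c2A c2P]] := IHq (x |: A) c1 c1P _ uq.
- exact: path_sorted pq.
- move=> y yq; rewrite !inE negb_or dA ?inE ?yq ?orbT // andbT.
  by apply: contraNneq xq => <-.
exists c2; split=> [y Ay|]; first by rewrite c2A ?c1A // inE Ay orbT.
move=> y y' hy hy'; apply: c2P; [move: hy|move: hy']; rewrite !inE;
  by case/or3P=> ->; rewrite ?orbT.
Qed.

Lemma max_path (S : {set T}) (p : seq T) x : path e x p -> uniq (x :: p) ->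
  {subset x :: p <= S} ->
  exists q, [/\ path e x (p ++ q), uniq (x :: p ++ q), {subset x :: p ++ q <= S} &
    forall y, y \in S -> e (last x (p ++ q)) y -> y \in x :: p ++ q].
Proof.
have [n] := ubnP (#|S| - size p); elim: n => // n IHn in p *; rewrite ltnS => len.
move=> pp up sp.
have [[y [Sy ey ny]]|max] := classic (exists y,
    [/\ y \in S, e (last x p) y & y \notin x :: p]).
- have pS : size (x :: p) < #|S|.
    rewrite -(card_uniqP up); apply: proper_card; apply/properP; split; first exact/subsetP.
    by exists y.
  have [||||q [qp qu qs qm]] := IHn (rcons p y).
  + by rewrite size_rcons; apply: leq_trans len; rewrite subnSK // ltnW.
  + by rewrite rcons_path pp.
  + by rewrite -rcons_cons rcons_uniq ny.
  + by move=> z; rewrite -rcons_cons mem_rcons inE => /predU1P[->|/sp].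
  by exists (y :: q); rewrite -cat_rcons.
exists [::]; rewrite cats0; split=> // y Sy ey.
by apply: contraT => ny; case: max; exists y.
Qed.

(** Used on a cycle cut open before [x]: the property [h] is lost somewhere
    between consecutive vertices. *)
Lemma switch_point (h : pred T) x p : has h (x :: p) -> ~~ h (last x p) ->
  exists C1 a b C2, [/\ x :: p = C1 ++ a :: b :: C2, h a & ~~ h b].
Proof.
elim: p x => [|y p IHp] x /=; first by rewrite orbF => ->.
case hy: (has h (y :: p)).
  move=> _ hl; have [C1 [a [b [C2 [E ha hb]]]]] := IHp y hy hl.
  by exists (x :: C1), a, b, C2; rewrite E.
move: hy => /= /norP[hy hp]; rewrite (negPf hy) (negPf hp) !orbF => hx _.
by exists [::], x, y, p.
Qed.

Hypothesis noK4 : forall a b c d,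
  e a b -> e a c -> e a d -> e b c -> e b d -> e c d -> False.

Lemma sub_proper (A B : {set T}) c : A \subset B -> proper_on B c -> proper_on A c.
Proof. by move=> /subsetP sAB cP x y /sAB Ax /sAB Ay; apply: cP. Qed.

Lemma nonadjacent_nbrs (S : {set T}) v : 2 < #|[set y in S | e v y]| ->
  exists x y, [/\ x \in S, y \in S, e v x, e v y & x != y /\ ~~ e x y].
Proof.
move=> /card_gt2P[a [b [c [[]]]]]; rewrite !inE => /andP[Sa ea] /andP[Sb eb] /andP[Sc ec].
move=> [ab bc ca].
case eab: (e a b); last by exists a, b; rewrite eab.
case ebc: (e b c); last by exists b, c; rewrite ebc.
case eca: (e c a); last by exists c, a; rewrite eca.
rewrite e_sym in eca; case: (noK4 ea eb ec eab eca ebc).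
Qed.

(** Zajac's proof, by induction on [S].  A vertex of degree less than 3 in [S] is
    coloured last.  Otherwise a path [v1, v2, v3] with [v1], [v3] nonadjacent is
    extended beyond [v3] to a path that cannot be prolonged.

    If the path covers [S], give [v1] and [v3] one colour.  The third neighbour
    [k] of [v2] cuts the rest of the path in two; colour greedily from [v3]
    towards [k], then from the end of the path back to [k], and finally [v2].

    If not, the neighbours of the last vertex [z] lie on a cycle [C] that ends
    the path.  Without edges from [C] to the other vertices of [S], both parts
    are coloured separately.  With such edges, two consecutive vertices [a], [b]
    of [C] can be chosen so that [a] has a neighbour [u] off [C] and [b] has
    none; colour [S] off [C], give [b] the colour of [u], and colour the cycle
    greedily from [b] round to [a], which sees one colour twice. *)
Lemma brooks_set (S : {set T}) : exists c, proper_on S c.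
Proof.
have [n] := ubnP #|S|; elim: n => // n IHn in S *; rewrite ltnS => leSn.
have IH (S' : {set T}) : S' \proper S -> exists c, proper_on S' c.
  by move=> pS; apply: IHn; apply: leq_trans (proper_card pS) leSn.
have [[v [Sv vdeg]]|full] :=
    classic (exists v, v \in S /\ #|[set y in S | e v y]| < 3).
  have [c cP] := IH _ (properD1 Sv).
  have [||c' [_ c'P]] := extend_color cP (v := v); rewrite ?inE ?eqxx //.
    apply: leq_ltn_trans (leq_imset_card _ _) _; apply: leq_ltn_trans vdeg.
    by apply: subset_leq_card; apply/subsetP=> y; rewrite !inE => /andP[/andP[_ ->]].
  by exists c'; rewrite setD1K in c'P.
have {}full v : v \in S -> 2 < #|[set y in S | e v y]|.
  by move=> Sv; rewrite ltnNge; apply/negP=> le; apply: full; exists v.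
have [->|[v2 Sv2]] := set_0Vmem S; first by exists (fun _ => ord0) => x y; rewrite inE.
have [v1 [v3 [Sv1 Sv3 e21 e23 [v13 n13]]]] := nonadjacent_nbrs (full v2 Sv2).
have v12 : v1 != v2 by apply: contraTneq e21 => ->; rewrite e_irr.
have v23 : v2 != v3 by apply: contraTneq e23 => ->; rewrite e_irr.
have [|||r] := @max_path S [:: v2; v3] v1.
- by rewrite /= e_sym e21 e23.
- by rewrite /= !inE negb_or v12 v13 v23.
- by move=> y; rewrite !inE => /or3P[] /eqP->.
set p := [:: v2; v3] ++ r => -[pp up sp pmax].
have [/subsetP SP|/subsetPn[s Ss sP]] := boolP (S \subset [set x in v1 :: p]).
  have {}SP x : x \in S -> x \in v1 :: p by move=> /SP; rewrite inE.
  have [k [Sk e2k kr]] : exists k, [/\ k \in S, e v2 k & k \in r].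
    have : 0 < #|[set y in S | e v2 y] :\ v1 :\ v3|.
      have := full v2 Sv2; rewrite (cardsD1 v1) (cardsD1 v3 (_ :\ _)).
      by case: #|_| => //; case: (v1 \in _); case: (v3 \in _).
    case/card_gt0P=> k; rewrite !inE => /and4P[k3 k1 Sk e2k]; exists k; split=> //.
    have := SP k Sk; rewrite !inE (negPf k3) (negPf k1) /=.
    by case: eqP e2k => [->|//]; rewrite e_irr.
  case/splitPr: r / kr => r1 r2 in p pp up sp pmax SP *.
  have nv x : x \in r1 ++ k :: r2 -> [/\ x != v1, x != v2 & x != v3].
    move=> xr; split; apply: contraTneq xr => ->; move: up => /=; rewrite -/(cat _ _) !inE.
    - by rewrite !negb_or => /and4P[/and3P[]].
    - by rewrite !negb_or => /and4P[_ /andP[]].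
    - by case/and4P.
  have v2n : v2 \notin r1 ++ k :: r2 by apply/negP=> /nv[_]; rewrite eqxx.
  have ur : uniq (r1 ++ k :: r2) by case/and4P: up.
  have [c1 [c1A c1P]] : exists c, {in [set v1; v3], c =1 fun=> ord0} /\
      proper_on ([set v1; v3] :|: [set x in r1]) c.
    apply: (greedy (z := k)).
    - move=> x y; rewrite !inE => /orP[]/eqP-> /orP[]/eqP->;
        by rewrite ?e_irr // ?(negPf n13) // e_sym (negPf n13).
    - apply: (path_sorted (x := v3)); move: pp.
      by rewrite /= => /and3P[_ _]; rewrite cat_path rcons_path /= => /and3P[-> ->].
    - by move: ur; rewrite -cat_rcons cat_uniq => /and3P[].
    - move=> x xr; have [] := nv x; last by move=> xv1 _ xv3; rewrite !inE negb_or xv1.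
      by move: xr; rewrite mem_rcons !inE mem_cat inE => /orP[]->; rewrite ?orbT.
  have c1v1 : c1 v1 = ord0 by rewrite c1A // !inE eqxx.
  have c1v3 : c1 v3 = ord0 by rewrite c1A // !inE eqxx orbT.
  (* from the end of the path back to k, leaving v2 *)
  move: c1P; set A1 := (X in proper_on X c1) => c1P.
  have [|||c2 [c2A c2P]] := greedy (q := rev (k :: r2)) (z := v2) c1P.
  - rewrite -rev_cons rev_sorted (eq_sorted (e' := e)) => [|x y]; last exact: e_sym.
    by move: pp; rewrite /= e2k => /and3P[_ _]; rewrite cat_path /= => /and3P[_ _].
  - rewrite -rev_cons rev_uniq cons_uniq; move: ur; rewrite cat_uniq => /and3P[_ _ ->]; rewrite andbT.
    by apply/negP=> v2r; have [] := nv v2; rewrite ?mem_cat ?v2r ?orbT // eqxx.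
  - move=> x; rewrite -rev_cons mem_rev => xq; rewrite /A1 !inE !negb_or.
    move: xq; rewrite in_cons => /predU1P[->|xq].
      rewrite v23 eq_sym v12 /=.
      by apply/negP=> v2r; have [] := nv v2; rewrite ?mem_cat ?v2r ?orbT // eqxx.
    have [|xv1 _ xv3] := nv x; first by rewrite mem_cat xq orbT.
    rewrite (negPf xv1) (negPf xv3) /=; apply/negP=> xr1.
    by move: ur; rewrite cat_uniq => /and3P[_ /hasPn/(_ x xq)/negP].
  have [||||||c3 [_ c3P]] := extend_same_color (v := v2) (x := v1) (y := v3) c2P.
  - move: v2n; rewrite !inE mem_rev inE mem_cat inE !negb_or (eq_sym v2 v1) v12 v23 /=.
    by case/and3P=> -> -> ->.
  - by [].
  - by [].
  - by rewrite !inE eqxx.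
  - by [].
  - by rewrite !c2A ?c1v1 ?c1v3 // !inE eqxx ?orbT.
  exists c3; apply: sub_proper c3P; apply/subsetP=> x /SP; rewrite !inE mem_cat mem_rev !inE.
  by case/or4P=> [->|->|->|/or3P[]->]; rewrite ?orbT.
set z := last v1 p in pmax.
have Sz : z \in S by apply: sp; rewrite mem_last.
have hz : has (e z) (v1 :: p).
  have [y [_ [Sy _ ezy _ _]]] := nonadjacent_nbrs (full z Sz).
  by apply/hasP; exists y => //; apply: pmax.
have [P1 [j [P2 [EP ezj P1z]]]] : exists P1 j P2,
    [/\ v1 :: p = P1 ++ j :: P2, e z j & ~~ has (e z) P1].
  set i := find (e z) (v1 :: p).
  exists (take i (v1 :: p)), (nth z (v1 :: p) i), (drop i.+1 (v1 :: p)); split.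
  - by rewrite -drop_nth ?cat_take_drop // -has_find.
  - exact: nth_find.
  - by rewrite has_take // ltnn.
have Ez : z = last j P2 by rewrite /z -[last v1 p]/(last v1 (v1 :: p)) EP last_cat.
have pC : path e j P2.
  by have : sorted e (P1 ++ j :: P2); [rewrite -EP | case/cat_sorted2].
have uC : uniq (j :: P2) by move: up; rewrite EP cat_uniq => /and3P[].
have sC x : x \in j :: P2 -> x \in S.
  by move=> xC; apply: sp; rewrite EP mem_cat xC orbT.
have zC y : y \in S -> e z y -> y \in j :: P2.
  move=> Sy ezy; have := pmax y Sy ezy; rewrite EP mem_cat => /orP[yP1|] //.
  by case/hasP: P1z; exists y.
(* C is j :: P2: it starts at the first neighbour of z on the path *)
set A := S :\: [set x in j :: P2].
have pA : A \proper S.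
  apply/properP; split; first exact: subsetDl.
  by exists j; [apply: sC; rewrite inE eqxx | rewrite !inE eqxx].
have [c cP] := IH A pA.
pose h v := [exists u in A, e v u].
have [hC|nhC] := boolP (has h (j :: P2)); last first.
  have [|c' c'P] := IH [set x in j :: P2].
    apply/properP; split; first by apply/subsetP=> x; rewrite inE => /sC.
    exists s => //; rewrite inE; apply: contra sP; rewrite inE EP mem_cat => ->.
    by rewrite orbT.
  have sep x y : x \in j :: P2 -> y \in A -> ~~ e x y.
    by move=> xC Ay; apply: contra nhC => exy; apply/hasP; exists x => //; apply/exists_inP; exists y.
  exists (fun x => if x \in j :: P2 then c' x else c x) => x y Sx Sy exy.
  case: ifP => Cx; case: ifP => Cy.
  - by apply: c'P; rewrite ?inE.
  - by have := sep x y Cx; rewrite exy => /(_ _)/negP; case; rewrite // inE Sy inE Cy.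
  - by have := sep y x Cy; rewrite e_sym exy => /(_ _)/negP; case; rewrite // inE Sx inE Cx.
  - by apply: cP; rewrite // inE ?Sx ?Sy inE ?Cx ?Cy.
have [|C1 [a [b [C2 [EC ha hb]]]]] := switch_point hC.
  rewrite -Ez; apply/exists_inP=> -[y]; rewrite !inE => /andP[/norP[yj yP2] Sy] ezy.
  by have := zC y Sy ezy; rewrite inE (negPf yj) (negPf yP2).
have /exists_inP[u Au eau] := ha.
have memC x : (x \in j :: P2) = [|| x == a, x == b, x \in C1 | x \in C2].
  by rewrite EC mem_cat !inE; case: (x == a); case: (x == b); rewrite ?orbT.
have nAC x : x \in j :: P2 -> x \notin A by move=> xC; rewrite inE inE xC.
have bA : b \notin A by apply: nAC; rewrite memC eqxx orbT.
pose c1 x := if x == b then c u else c x.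
have c1P : proper_on (b |: A) c1.
  have nbA y : y \in A -> e b y = false.
    by move=> Ay; apply: contraNF hb => eby; apply/exists_inP; exists y.
  have nb y : y \in A -> (y == b) = false by move=> Ay; apply: contraNF bA => /eqP<-.
  move=> x y /setU1P[->|Ax] /setU1P[->|Ay]; rewrite /c1.
  - by rewrite e_irr.
  - by rewrite nbA.
  - by rewrite e_sym nbA.
  - by rewrite !nb //; apply: cP.
(* the cycle read from b round to a *)
have uC' : uniq (b :: rcons (C2 ++ C1) a).
  rewrite (perm_uniq (s2 := j :: P2)) // EC.
  by rewrite rcons_cat -cat_cons perm_catC cat_rcons.
have [|||c2 [c2A c2P]] := greedy (q := C2 ++ C1) (z := a) c1P.
- rewrite rcons_cat; apply: (path_sorted (x := b)).
  have sE : sorted e (C1 ++ a :: b :: C2) by rewrite -EC.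
  have [eab pb] : e a b /\ path e b C2 by case: (cat_sorted2 sE) => _ /andP[].
  rewrite cat_path pb andTb; have -> : last b C2 = z by rewrite Ez -[last j P2]/(last j (j :: P2)) EC last_cat.
  case: C1 EC sE {memC uC'} => [|j' C1] /= [Ej _] sE; first by rewrite -Ej ezj.
  by rewrite -Ej ezj rcons_path Ej; move: sE; rewrite cat_path /= => /and3P[-> ->].
- by case/andP: uC'.
- move=> x xq; have/andP[bq _] := uC'; rewrite inE negb_or nAC ?andbT.
    by rewrite inE; apply: contraNneq bq => <-.
  by move: xq; rewrite mem_rcons inE mem_cat memC => /or3P[]->; rewrite ?orbT.
have ub : u != b by apply: contraTneq Au => ->.
have [||||||c3 [_ c3P]] := extend_same_color (v := a) (x := u) (y := b) c2P.
- move: uC'; rewrite cons_uniq rcons_uniq mem_rcons inE negb_or => /and3P[/andP[ba _] aq _].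
  rewrite in_setU in_setU1 !negb_or (eq_sym a) ba nAC; last by rewrite memC eqxx.
  by rewrite inE aq.
- done.
- by have : sorted e (C1 ++ a :: b :: C2); [rewrite -EC | case/cat_sorted2=> _ /andP[]].
- by rewrite 2!in_setU Au orbT.
- done.
- by rewrite !c2A ?in_setU1 ?Au ?eqxx ?orbT // /c1 eqxx (negPf ub).
exists c3; apply: sub_proper c3P; apply/subsetP=> x Sx.
have [xC|nxC] := boolP (x \in j :: P2).
  by move: xC; rewrite memC !inE mem_cat => /or4P[]->; rewrite ?orbT.
have Ax : x \in A by rewrite inE Sx inE nxC.
by rewrite !in_setU Ax !orbT.
Qed.
End Brooks.

(** * Triangles and diamonds *)

Section Local.
Variable G : sgraph.
Implicit Types (x y z v w : G) (D S : {set G}).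

Definition tri x y := adj x y && [exists z, adj x z && adj y z].
Definition bare x y := adj x y && ~~ tri x y.
Definition in_triangle x := [exists y, tri x y].
(** For a pick [y] of a triangle or of a diamond, [own y v] says that [v] is in the
    same triangle or diamond. *)
Definition own y v := (y == v) || tri y v.
(** The middle vertices of the diamonds: in the absence of K4 three triangular
    edges at [x] force two triangles on a common edge (see [midP]). *)
Definition mid x := 2 < #|[set y | tri x y]|.
Definition plain x := in_triangle x && [forall y, own x y ==> ~~ mid y].

Definition near x y := [|| adj x y, [exists a, adj x a && adj a y] |
  [exists a, exists b, [&& adj x a, adj a b & adj b y]]].

(** Perfect domination in the graph of triangular edges.  In a diamond an end
    vertex does not dominate the other end, so the pick is a middle vertex. *)
Definition perfect D := [/\ {in D, forall y, in_triangle y},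
  forall v, in_triangle v -> exists2 y, y \in D & own y v &
  forall y z v, y \in D -> z \in D -> own y v -> own z v -> y = z].

(** Two picks violating this are at distance 3 through a third triangle, although
    their own triangles need not be joined by a link. *)
Definition separated D := forall x s t y,
  x \in D -> y \in D -> bare x s -> tri s t -> bare t y -> x = y.

(** The connections of length at most 3 between triangles or diamonds that do not
    run through a further one. *)
Inductive link s f : Prop :=
| Link0 of in_triangle s & in_triangle f & bare s f
| Link1 w of in_triangle s & in_triangle f & ~~ in_triangle w & adj s w & adj w f & s != f
| Link2 w w' of in_triangle s & in_triangle f & ~~ in_triangle w & ~~ in_triangle w' &
    adj s w & adj w w' & adj w' f.

Hypothesis deg3 : forall x, #|[set y | adj x y]| <= 3.
Hypothesis clawfree : forall x a b c, adj x a -> adj x b -> adj x c ->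
  a != b -> a != c -> b != c -> [|| adj a b, adj a c | adj b c].
Hypothesis noK4 : forall a b c d : G,
  adj a b -> adj a c -> adj a d -> adj b c -> adj b d -> adj c d -> False.

Lemma adjC x y : adj x y = adj y x. Proof. exact: adj_sym. Qed.
Lemma adj_neq x y : adj x y -> x != y.
Proof. by apply: contraTneq => ->; rewrite adj_irrefl. Qed.

Lemma triP x y : reflect (adj x y /\ exists z, adj x z /\ adj y z) (tri x y).
Proof.
apply: (iffP andP) => [[axy /existsP[z /andP[xz yz]]]|[axy [z [xz yz]]]]; split=> //.
  by exists z.
by apply/existsP; exists z; rewrite xz.
Qed.

Lemma tri_adj x y : tri x y -> adj x y. Proof. by case/andP. Qed.
Lemma bare_adj x y : bare x y -> adj x y. Proof. by case/andP. Qed.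
Lemma triC x y : tri x y = tri y x.
Proof.
by rewrite /tri adjC; congr andb; apply: eq_existsb => z; rewrite andbC.
Qed.
Lemma bareC x y : bare x y = bare y x. Proof. by rewrite /bare adjC triC. Qed.
Lemma tri_irr x : tri x x = false. Proof. by rewrite /tri adj_irrefl. Qed.
Lemma ownxx x : own x x. Proof. by rewrite /own eqxx. Qed.
Lemma tri_own x y : tri x y -> own x y. Proof. by rewrite /own => ->; rewrite orbT. Qed.
Lemma ownC x y : own x y = own y x. Proof. by rewrite /own eq_sym triC. Qed.
Lemma adj_cases x y : adj x y -> tri x y \/ bare x y.
Proof. by move=> a; rewrite /bare a; case: (tri x y); [left|right]. Qed.
Lemma bare_ntri x y : bare x y -> tri x y = false.
Proof. by case/andP=> _ /negPf. Qed.
Lemma tri3 x y z : adj x y -> adj x z -> adj y z -> tri x y.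
Proof. by move=> xy xz yz; apply/triP; split=> //; exists z. Qed.
Lemma tri_intri x y : tri x y -> in_triangle x.
Proof. by move=> t; apply/existsP; exists y. Qed.
Lemma tri_intri2 x y : tri x y -> in_triangle y.
Proof. by rewrite triC; apply: tri_intri. Qed.
Lemma own_intri y v : in_triangle y -> own y v -> in_triangle v.
Proof. by move=> iy /predU1P[<-|/tri_intri2]. Qed.
Lemma nontri_bare x y : ~~ in_triangle y -> adj x y -> bare x y.
Proof. by move=> ny /adj_cases[/tri_intri2|//]; rewrite (negPf ny). Qed.

Lemma four_nbrs x a b c d : adj x a -> adj x b -> adj x c -> adj x d ->
  ~~ uniq [:: a; b; c; d].
Proof.
move=> xa xb xc xd; apply/negP=> u; have := deg3 x; apply/negP; rewrite -ltnNge.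
rewrite -[3.+1]/(size [:: a; b; c; d]) -(card_uniqP u).
apply/subset_leq_card/subsetP=> y; rewrite !inE.
by case/or4P=> /eqP->.
Qed.

Lemma nbr3 x a b c y : adj x a -> adj x b -> adj x c -> a != b -> a != c -> b != c ->
  adj x y -> [\/ y = a, y = b | y = c].
Proof.
move=> xa xb xc ab ac bc xy; have := four_nbrs xa xb xc xy.
rewrite /= !inE !negb_or (negPf ab) (negPf ac) (negPf bc) /= andbT.
by rewrite !negb_and !negbK => /or3P[]/eqP->; [constructor 1|constructor 2|constructor 3].
Qed.

(** Otherwise [x] would have degree 4. *)
Lemma bare_unique x y z : in_triangle x -> bare x y -> bare x z -> y = z.
Proof.
move=> /existsP[p tp] by_ bz; have [ap [q [aq pq]]] := triP _ _ tp.
have tq : tri x q by apply: (tri3 aq ap); rewrite adjC.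
have ny u r : bare x u -> tri x r -> u != r.
  by move=> /bare_ntri nt; apply: contraTneq => <-; rewrite nt.
have [->|E|E] // := nbr3 (bare_adj by_) ap aq (ny _ _ by_ tp) (ny _ _ by_ tq)
  (adj_neq pq) (bare_adj bz).
- by have := ny z p bz tp; rewrite E eqxx.
- by have := ny z q bz tq; rewrite E eqxx.
Qed.

(** Three neighbours of [x] would form a claw. *)
Lemma nontri_deg2 x a b c : ~~ in_triangle x -> adj x a -> adj x b -> adj x c ->
  a != b -> c = a \/ c = b.
Proof.
move=> nx xa xb xc ab.
have nt u v : adj x u -> adj x v -> adj u v = false.
  move=> xu xv; apply: contraNF nx => uv; exact: (tri_intri (tri3 xu xv uv)).
have [->|ca] := eqVneq c a; first by left.
have [->|cb] := eqVneq c b; first by right.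
have := clawfree xa xb xc ab; rewrite eq_sym ca eq_sym cb => /(_ isT isT).
by rewrite (nt a b xa xb) (nt a c xa xc) (nt b c xb xc).
Qed.

Section PerfectSet.
Variable D : {set G}.
Hypothesis perfD : perfect D.

Lemma perf_intri y : y \in D -> in_triangle y. Proof. by case: perfD => h _ _; apply: h. Qed.
Lemma perf_owner v : in_triangle v -> exists2 y, y \in D & own y v.
Proof. by case: perfD => _ h _; apply: h. Qed.
Lemma perf_unique y z v : y \in D -> z \in D -> own y v -> own z v -> y = z.
Proof. by case: perfD => _ _; apply. Qed.

(** A pick dominates the whole triangle or diamond: if [s] and [r] had different
    owners, then [s], [r] and their common neighbour would be so crowded that the
    common neighbour has degree 4. *)
Lemma own_tri y s r : y \in D -> own y s -> tri s r -> own y r.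
Proof.
move=> Dy /predU1P[->|ys]; first exact: tri_own.
move=> sr; have [z Dz zr] := perf_owner (tri_intri2 sr).
have fin : own z s -> own y r.
  by move=> zs; rewrite (perf_unique Dy Dz (tri_own ys) zs).
case/predU1P: zr => [zr|zr]; first by apply: fin; rewrite zr tri_own // triC.
have [asr [q [sq rq]]] := triP _ _ sr.
have [->|ry] := eqVneq r y; first exact: ownxx.
have [E|zs] := eqVneq z s; first by apply: fin; rewrite E ownxx.
have [azr [p [zp rp]]] := triP _ _ zr.
have [ays [p' [yp' sp']]] := triP _ _ ys.
have [Eyz|yz] := eqVneq y z; first by rewrite Eyz tri_own.
have [yr|nyr] := boolP (adj y r).
  by apply: tri_own; apply: (tri3 yr ays); rewrite adjC.
have [zs'|nzs] := boolP (adj z s).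
  by apply: fin; apply: tri_own; apply: (tri3 zs' azr).
have qy : q != y by apply: contraNneq nyr => <-; rewrite adjC.
have qz : q != z by apply: contraNneq nzs => <-; rewrite adjC.
have asy : adj s y by rewrite adjC.
have sz : s != z by rewrite eq_sym.
have arz : adj r z by rewrite adjC.
have ars : adj r s by rewrite adjC.
have yq : adj y q.
  have [E|<- //|E] := nbr3 asr sq asy (adj_neq rq) ry qy sp'.
    by rewrite -E yp' in nyr.
  by rewrite E adj_irrefl in yp'.
have zq : adj z q.
  have [E|<- //|E] := nbr3 ars rq arz (adj_neq sq) sz qz rp.
    by rewrite -E zp in nzs.
  by rewrite E adj_irrefl in zp.
have := @four_nbrs q s r y z; rewrite !(adjC q) sq rq yq zq => /(_ isT isT isT isT).
rewrite /= !inE !negb_or (adj_neq asr) (adj_neq asy) (eq_sym s z) zs ry (adj_neq arz).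
by rewrite yz.
Qed.
End PerfectSet.

Lemma bare_own_neq x y v : bare x y -> own x v -> v != y.
Proof.
move=> b; apply: contraTneq => ->; rewrite /own negb_or (bare_ntri b) andbT.
exact: adj_neq (bare_adj b).
Qed.

(** * Picks at distance at most 3 *)

Lemma link_sym s f : link s f -> link f s.
Proof.
case=> [is_ if_ b|w is_ if_ nw sw wf nsf|w w' is_ if_ nw nw' sw ww' wf].
- by apply: Link0 => //; rewrite bareC.
- by apply: (@Link1 f s w) => //; rewrite 1?adjC // eq_sym.
- by apply: (@Link2 f s w' w) => //; rewrite adjC.
Qed.

Lemma link_intri s f : link s f -> in_triangle s /\ in_triangle f.
Proof. by case. Qed.

Lemma intri_neq x y : in_triangle x -> ~~ in_triangle y -> x != y.
Proof. by move=> ix; apply: contraNneq => <-. Qed.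

Lemma link_first s f : link s f -> exists w, bare s w.
Proof. by case=> [_ _ b|w _ _ nw sw _ _|w w' _ _ nw _ sw _ _]; [exists f|exists w|exists w] => //; apply: nontri_bare. Qed.

(** A link has no branching: its first vertex has one bare edge and its inner
    vertices have degree 2. *)
Lemma link_fun s f f' : link s f -> link s f' -> f = f'.
Proof.
have key w w' : in_triangle s -> ~~ in_triangle w -> adj s w -> bare s w' -> w' = w.
  by move=> is_ nw sw b; apply: bare_unique is_ b (nontri_bare nw sw).
have nxt w u u' : ~~ in_triangle w -> adj s w -> adj w u -> adj w u' -> s != u -> s != u' -> u = u'.
  move=> nw sw wu wu' su su'; have ws : adj w s by rewrite adjC.
  by case: (nontri_deg2 nw ws wu wu' su) => // E; rewrite E eqxx in su'.
case=> [is_ if_ b|w is_ if_ nw sw wf nsf|w w2 is_ if_ nw nw2 sw ww2 wf];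
  case=> [_ if' b'|v _ if' nv sv vf' nsf'|v v2 _ if' nv nv2 sv vv2 vf'].
- exact: bare_unique b b'.
- by rewrite (key v f) // in if_; rewrite if_ in nv.
- by rewrite (key v f) // in if_; rewrite if_ in nv.
- by rewrite (key w f') // in if'; rewrite if' in nw.
- have Ev := key v w is_ nv sv (nontri_bare nw sw); rewrite -{}Ev in vf' nv sv.
  exact: nxt vf' nsf nsf'.
- have Ev := key v w is_ nv sv (nontri_bare nw sw); rewrite -{}Ev in vv2 nv sv.
  by move: if_; rewrite (nxt w f v2) // ?(intri_neq is_ nv2) // (negPf nv2).
- by rewrite (key w f') // in if'; rewrite if' in nw.
- have Ev := key v w is_ nv sv (nontri_bare nw sw); rewrite -{}Ev in vf' nv sv.
  by move: if'; rewrite (nxt w f' w2) // ?(intri_neq is_ nw2) // (negPf nw2).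
- have Ev := key v w is_ nv sv (nontri_bare nw sw); rewrite -{}Ev in vv2 nv sv.
  have E2 : w2 = v2 by apply: nxt ww2 vv2 _ _ => //; exact: intri_neq.
  rewrite -{}E2 in vf' nv2 vv2.
  have w2w : adj w2 w by rewrite adjC.
  have wf_neq : w != f by rewrite eq_sym intri_neq.
  case: (nontri_deg2 nw2 w2w wf vf' wf_neq) => // E.
  by rewrite -E if' in nw.
Qed.

(** A walk of length at most 3 between two picks is classified by the kinds of its
    edges.  The last clause records that a link with inner vertices leaves so
    little room that it starts or ends at a pick. *)
Lemma near_link D x y : perfect D -> separated D -> x \in D -> y \in D -> x != y ->
  near x y -> exists s f, [/\ own x s, own y f, link s f & [\/ bare s f, s = x | f = y]].
Proof.
move=> pD sD Dx Dy xy.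
have ix := perf_intri pD Dx; have iy := perf_intri pD Dy.
have no v : own x v -> own y v -> False.
  by move=> xv yv; rewrite (perf_unique pD Dx Dy xv yv) eqxx in xy.
have own1 v : own x v -> v != y.
  by move=> xv; apply/eqP=> E; apply: (no y); rewrite ?ownxx // -E.
have own2 v : own y v -> x != v.
  by move=> yv; apply/eqP=> E; apply: (no x); rewrite ?ownxx // E.
have len1 : adj x y -> exists s f, [/\ own x s, own y f, link s f & [\/ bare s f, s = x | f = y]].
  case/adj_cases=> b; first by case: (no y); rewrite ?ownxx ?tri_own.
  by exists x, y; split; rewrite ?ownxx //; [apply: Link0|constructor 1].
have direct s f : own x s -> own y f -> bare s f ->
    exists s f, [/\ own x s, own y f, link s f & [\/ bare s f, s = x | f = y]].
  move=> xs yf b; exists s, f; split=> //; last by constructor 1.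
  by apply: Link0 => //; [exact: own_intri ix xs | exact: own_intri iy yf].
case/or3P=> [//|/existsP[a /andP[xa ay]]|/existsP[a /existsP[b /and3P[xa ab by_]]]].
- case: (adj_cases xa) => txa; case: (adj_cases ay) => tay.
  + by case: (no a); [exact: tri_own | rewrite ownC tri_own].
  + by apply: direct tay; rewrite ?ownxx ?tri_own.
  + by apply: direct txa; rewrite ?ownxx // ownC tri_own.
  have [ia|na] := boolP (in_triangle a).
    by move: xy; rewrite (bare_unique ia tay (_ : bare a x)) ?eqxx // bareC.
  by exists x, y; split; rewrite ?ownxx //; [apply: (@Link1 x y a)|constructor 2].
- case: (adj_cases xa) => txa.
  + have oxa := tri_own txa; have ia := own_intri ix oxa.
    case: (adj_cases ab) => tab.
      have oxb := own_tri pD Dx oxa tab.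
      case: (adj_cases by_) => tby; first by case: (no b); rewrite // ownC tri_own.
      by apply: direct tby; rewrite ?ownxx.
    case: (adj_cases by_) => tby; first by apply: direct tab; rewrite // ownC tri_own.
    have [ib|nb] := boolP (in_triangle b).
      have E : a = y by apply: bare_unique ib _ tby; rewrite bareC.
      by have := own1 a oxa; rewrite E eqxx.
    exists a, y; split; rewrite ?ownxx //; last by constructor 3.
    by apply: (@Link1 a y b) => //; exact: own1.
  case: (adj_cases ab) => tab.
    case: (adj_cases by_) => tby.
      apply: (direct x a); rewrite ?ownxx //.
      by apply: (own_tri pD Dy (s := b)); rewrite 1?triC // ownC tri_own.
    by move: xy; rewrite (sD x a b y) ?eqxx.
  have [ia|na] := boolP (in_triangle a).
    by apply: len1; rewrite (bare_unique ia (_ : bare a x) tab) // bareC.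
  case: (adj_cases by_) => tby.
    exists x, b; split; rewrite ?ownxx ?[own y b]ownC ?tri_own //; last by constructor 2.
    apply: (@Link1 x b a) => //; first exact: tri_intri tby.
    by apply: own2; rewrite ownC tri_own.
  have [ib|nb] := boolP (in_triangle b).
    have E : a = y by apply: bare_unique ib _ tby; rewrite bareC.
    by rewrite E iy in na.
  exists x, y; split; rewrite ?ownxx //; last by constructor 2.
  exact: (@Link2 x y a b).
Qed.

Definition exits x := [set s | own x s && [exists w, bare s w]].

Lemma link_exits x s f : own x s -> link s f -> s \in exits x.
Proof. by move=> xs /link_first[w b]; rewrite inE xs; apply/existsP; exists w. Qed.

(** A vertex with a bare edge has at most two triangular edges. *)
Lemma card_exits x : #|exits x| <= 3.
Proof.
have [[q bq]|nb] := classic (exists q, bare x q).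
  have -> : 3 = (1 + 2)%N by [].
  apply: leq_trans (subset_leq_card (B := x |: ([set y | adj x y] :\ q)) _) _.
    apply/subsetP=> s; rewrite !inE => /andP[/predU1P[->|xs] _]; first by rewrite eqxx.
    by rewrite (tri_adj xs) andbT (bare_own_neq bq (tri_own xs)) orbT.
  apply: leq_trans (leq_card_setU _ _).1 _; rewrite cards1 leq_add2l.
  by have := deg3 x; rewrite (cardsD1 q) inE (bare_adj bq) add1n ltnS.
apply: leq_trans (deg3 x); apply: subset_leq_card; apply/subsetP=> s.
rewrite !inE => /andP[/predU1P[<-|/tri_adj//] /existsP[w b]].
by case: nb; exists w.
Qed.

(** A pick in conflict with [x] is determined by the exit at which the link leaves
    the component of [x]. *)
Lemma conflict_degree D x : perfect D -> separated D -> x \in D ->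
  #|[set y in D | (x != y) && near x y]| <= 3.
Proof.
move=> pD sD Dx; set Y := [set y in D | _].
pose rel_ y s := own x s /\ exists f, own y f /\ link s f.
have /fin_all_exists[h hP] : forall y, exists s, y \in Y -> rel_ y s.
  move=> y; have [|nY] := boolP (y \in Y); last by exists x.
  rewrite inE => /and3P[Dy xy nxy].
  have [s [f [xs yf l _]]] := near_link pD sD Dx Dy xy nxy.
  by exists s => _; split=> //; exists f.
have hinj : {in Y &, injective h}.
  move=> y z Yy Yz E; have [_ [f [yf l]]] := hP y Yy; have [_ [f' [zf' l']]] := hP z Yz.
  rewrite -E in l'; rewrite -(link_fun l l') in zf'.
  by move: Yy Yz; rewrite !inE => /andP[Dy _] /andP[Dz _]; apply: (perf_unique pD Dy Dz yf).
rewrite -(card_in_imset hinj); apply: leq_trans (card_exits x).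
apply: subset_leq_card; apply/subsetP=> _ /imsetP[y Yy ->].
by have [xs [f [_ l]]] := hP y Yy; apply: link_exits l.
Qed.

(** [a], [c], [d] are all the neighbours of [x], and [c] is the other middle vertex.
    Each of them is adjacent to another one, so there are at least two edges
    among them, and a third one would give a K4. *)
Lemma midP x : mid x -> exists a c d,
  [/\ tri x a, tri x c, tri x d, adj a c /\ adj c d & a != d /\ ~~ adj a d].
Proof.
move=> /card_gt2P[p [q [r [[]]]]]; rewrite !inE => tp tq tr [pq qr rp].
have [ap aq ar] := And3 (tri_adj tp) (tri_adj tq) (tri_adj tr).
have nb y : adj x y -> [\/ y = p, y = q | y = r].
  by apply: nbr3 => //; rewrite eq_sym.
have pr : p != r by rewrite eq_sym.
have mate u : tri x u -> exists2 v, [\/ v = p, v = q | v = r] & adj u v.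
  by case/triP=> _ [v [xv uv]]; exists v; first exact: nb.
have two u v w : adj x u -> adj x v -> adj x w -> adj u v -> adj v w -> adj u w -> False.
  by move=> xu xv xw uv vw uw; apply: (noK4 xu xv xw).
have build a c d : tri x a -> tri x c -> tri x d -> adj a c -> adj c d -> a != d ->
    exists a c d, [/\ tri x a, tri x c, tri x d, adj a c /\ adj c d & a != d /\ ~~ adj a d].
  move=> ta tc td ac cd ad; exists a, c, d; split=> //; split=> //; apply/negP=> aad.
  exact: (two a c d (tri_adj ta) (tri_adj tc) (tri_adj td) ac cd aad).
have [pq'|npq] := boolP (adj p q); have [qr'|nqr] := boolP (adj q r);
  have [pr'|npr] := boolP (adj p r); try by [exact: (build p q r) |
   apply: (build r p q); rewrite // 1?adjC // eq_sym | 
   apply: (build p r q); rewrite // adjC].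
- by have [v [] -> av] := mate r tr; [rewrite adjC av in npr|rewrite adjC av in nqr|rewrite adj_irrefl in av].
- by have [v [] -> av] := mate p tp; [rewrite adj_irrefl in av|rewrite av in npq|rewrite av in npr].
- by have [v [] -> av] := mate q tq; [rewrite adjC av in npq|rewrite adj_irrefl in av|rewrite av in nqr].
- by have [v [] -> av] := mate q tq; [rewrite adjC av in npq|rewrite adj_irrefl in av|rewrite av in nqr].
Qed.

Lemma three_tri_mid x a b c : tri x a -> tri x b -> tri x c -> a != b -> a != c -> b != c -> mid x.
Proof.
by move=> ta tb tc ab ac bc; apply/card_gt2P; exists a, b, c; rewrite !inE (eq_sym c) ac ab bc.
Qed.

Lemma mid_bare x y : mid x -> bare x y -> False.
Proof.
case/midP=> a [c [d [ta tc td [ac cd] [ad nad]]]] b.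
by case: (nbr3 (tri_adj ta) (tri_adj tc) (tri_adj td) (adj_neq ac) ad (adj_neq cd) (bare_adj b)) => E;
  move: (bare_ntri b); rewrite E ?ta ?tc ?td.
Qed.

Lemma mid_adj_tri x y : mid x -> adj x y -> tri x y.
Proof. by move=> mx /adj_cases[//|/(mid_bare mx)]. Qed.

Lemma mid_intri x : mid x -> in_triangle x.
Proof. by case/midP=> a [c [d [ta _ _ _ _]]]; apply: tri_intri ta. Qed.

Lemma plain_intri x : plain x -> in_triangle x. Proof. by case/andP. Qed.
Lemma plain_nmid x y : plain x -> own x y -> ~~ mid y.
Proof. by case/andP=> _ /forallP/(_ y)/implyP; apply. Qed.

Lemma nplainP x : in_triangle x -> ~~ plain x -> exists2 m, own x m & mid m.
Proof.
move=> ix; rewrite /plain ix /= negb_forall => /existsP[m].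
by rewrite negb_imply negbK => /andP[]; exists m.
Qed.

(** * Plain triangles *)

Lemma tri_pair x p : ~~ mid x -> tri x p -> exists q,
  [/\ tri x q, tri p q, p != q & forall v, tri x v -> v = p \/ v = q].
Proof.
move=> nmx tp; have [ap [q [aq pq]]] := triP _ _ tp.
have tq : tri x q by apply: (tri3 aq ap); rewrite adjC.
exists q; split=> //; [|exact: adj_neq|].
  by apply: (tri3 pq (z := x)); rewrite adjC.
move=> v tv; have [->|vp] := eqVneq v p; first by left.
have [->|vq] := eqVneq v q; first by right.
by case/negP: nmx; apply: (three_tri_mid tp tq tv (adj_neq pq)); rewrite eq_sym.
Qed.

Lemma plain_own u y v : plain u -> tri u y -> own u v = own y v.
Proof.
move=> pu uy.
have [q [tq yq yq' uv]] := tri_pair (plain_nmid pu (ownxx u)) uy.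
have nmy : ~~ mid y by rewrite (plain_nmid pu) // tri_own.
have yu : tri y u by rewrite triC.
have [q2 [tq2 _ uq2 yv]] := tri_pair nmy yu.
have uq : u != q by apply: adj_neq; apply: tri_adj.
have Eq : q = q2 by case: (yv q yq) uq => [->|//]; rewrite eqxx.
rewrite -{}Eq in tq2 uq2 yv.
apply/idP/idP=> /predU1P[<-|].
- by apply: tri_own.
- by case/uv=> ->; [exact: ownxx|exact: tri_own].
- by apply: tri_own.
- by case/yv=> ->; [exact: ownxx|exact: tri_own].
Qed.

Lemma plain_tri u y : plain u -> tri u y -> plain y.
Proof.
move=> pu uy; rewrite /plain (tri_intri2 uy); apply/forallP=> m; apply/implyP.
by rewrite -(plain_own _ pu uy) => /(plain_nmid pu).
Qed.

Lemma plain_own_plain u y : plain u -> own u y -> plain y.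
Proof. by move=> pu /predU1P[<-//|]; apply: plain_tri. Qed.

Lemma mid_nplain m y : mid m -> own m y -> ~~ plain y.
Proof. by move=> mm; rewrite ownC => my; apply/negP=> /plain_nmid/(_ my); rewrite mm. Qed.

(** The end vertices of a diamond are joined by triangular edges only to its middle
    vertices. *)
Lemma diamond_end_mates w t : ~~ plain w -> ~~ mid w -> tri w t -> mid t.
Proof.
move=> npw nmw wt; have [m wm mm] := nplainP (tri_intri wt) npw.
have {}wm : tri w m by case/predU1P: wm => // E; rewrite E mm in nmw.
have {}wm' : tri m w by rewrite triC.
have [a [c [d [ta tc td [ac cd] [ad nad]]]]] := midP mm.
have ca : tri c a by apply: (tri3 (z := m)); rewrite adjC // tri_adj.
have cd' : tri c d by apply: (tri3 cd (z := m)); rewrite adjC tri_adj.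
have cm : tri c m by rewrite triC.
have mc : mid c.
  apply: (three_tri_mid ca cd' cm) => //; rewrite eq_sym; apply: adj_neq; exact: tri_adj.
have wc : tri w c.
  case: (nbr3 (tri_adj ta) (tri_adj tc) (tri_adj td) (adj_neq ac) ad (adj_neq cd) (tri_adj wm')) => E.
  - by rewrite E triC.
  - by rewrite E mc in nmw.
  - by rewrite E triC.
have [q [_ _ _ all]] := tri_pair nmw wm.
have Eq : c = q.
  by case: (all c wc) => // E; move: tc; rewrite E tri_irr.
by case: (all t wt) => ->; rewrite -?Eq.
Qed.

(** The two middle vertices of a diamond can replace each other as picks. *)
Lemma twin m : mid m -> exists c, [/\ mid c, tri m c, forall v, own m v = own c v &
  forall c', mid c' -> tri m c' -> c' = c].
Proof.
move=> mm; have [a [c [d [ta tc td [ac cd] [ad nad]]]]] := midP mm.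
have [ma mc md] := And3 (tri_adj ta) (tri_adj tc) (tri_adj td).
have [am cm dm] : [/\ adj a m, adj c m & adj d m] by rewrite !(adjC _ m).
have [ca dc] : adj c a /\ adj d c by rewrite adjC ac adjC cd.
have [tca tcd tcm] : [/\ tri c a, tri c d & tri c m].
  by split; [exact: tri3 ca cm am|exact: tri3 cd cm dm|exact: tri3 cm ca ma].
have nbm v : adj m v -> [\/ v = a, v = c | v = d].
  exact: (nbr3 ma mc md (adj_neq ac) ad (adj_neq cd)).
have nbc v : adj c v -> [\/ v = a, v = m | v = d].
  exact: (nbr3 ca cm cd (adj_neq am) ad (adj_neq md)).
have midc : mid c by apply: (three_tri_mid tca tcm tcd (adj_neq am) ad (adj_neq md)).
have ends x y : adj x m -> adj x c -> ~~ adj x y -> (forall v, adj m v -> [\/ v = x, v = c | v = y]) ->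
    (forall v, adj c v -> [\/ v = x, v = m | v = y]) -> ~~ mid x.
  move=> xm xc nxy nm nc; apply/negP=> mx.
  have mx' : adj m x by rewrite adjC.
  have tm : tri x m by apply: (tri3 xm xc).
  have : 0 < #|[set y | tri x y] :\ m :\ c|.
    move: mx; rewrite /mid (cardsD1 m) (cardsD1 c (_ :\ _)).
    by case: #|_| => //; case: (m \in _); case: (c \in _).
  case/card_gt0P=> v; rewrite !inE => /and3P[vc vm tv].
  have [xv [w [xw vw]]] := triP _ _ tv.
  have vx : v != x by rewrite eq_sym adj_neq.
  have nv : v != y by apply: contraNneq nxy => <-.
  case: (nbr3 xm xc xv (adj_neq mc) _ _ xw); try by rewrite eq_sym.
  - by move=> E; rewrite E adjC in vw; case: (nm v vw) => E'; rewrite E' eqxx in vx vc nv.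
  - by move=> E; rewrite E adjC in vw; case: (nc v vw) => E'; rewrite E' eqxx in vx vm nv.
  - by move=> E; rewrite E adj_irrefl in vw.
have na : ~~ mid a by apply: (ends a d).
have nd : ~~ mid d.
  apply: (ends d a) => //; first by rewrite adjC.
    by move=> v /nbm[]; [constructor 3|constructor 2|constructor 1].
  by move=> v /nbc[]; [constructor 3|constructor 2|constructor 1].
exists c; split=> // [v|c' mc' /tri_adj/nbm[] E].
  apply/idP/idP=> [/predU1P[<-|/tri_adj/nbm[]->]|/predU1P[<-|/tri_adj/nbc[]->]];
  by rewrite ?ownxx ?tri_own.
- by rewrite E (negPf na) in mc'.
- by [].
- by rewrite E (negPf nd) in mc'.
Qed.

Definition zone v := [set y | own v y].

Lemma zone_plain v y : plain v -> own v y -> zone v = zone y.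
Proof.
move=> pv /predU1P[->//|ty]; apply/setP=> x; rewrite !inE; exact: plain_own.
Qed.

Lemma card_zone v : plain v -> #|zone v| = 3.
Proof.
move=> pv; have /existsP[p tp] := plain_intri pv.
have [q [tq _ pq all]] := tri_pair (plain_nmid pv (ownxx v)) tp.
have -> : zone v = [set v; p; q].
  apply/setP=> x; rewrite !inE; apply/idP/idP=> [/predU1P[->|/all[]->]|]; rewrite ?eqxx ?orbT //.
  by case/orP=> [/orP[]|]/eqP->; rewrite ?ownxx ?tri_own.
have [vp vq] : v != p /\ v != q by split; apply/adj_neq/tri_adj.
by rewrite -setUA cardsU1 cards2 pq !inE negb_or vp vq.
Qed.

(** In each diamond the middle vertex that comes first in the enumeration is
    picked.  A plain triangle with a vertex whose bare edge, if any, does not lead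
    to a plain vertex picks this vertex.  The remaining plain triangles, those of
    [X], have three bare edges to plain triangles, and a plain triangle has at
    most three bare edges, so Hall's theorem gives them distinct plain triangles
    to point to.  Picks are then separated, since an edge [s t] as in [separated]
    always lies in a plain triangle. *)
Lemma exists_perfect_separated (x0 : G) : exists D, perfect D /\ separated D.
Proof.
pose X := [set zone v | v in [set v | plain v &
  [forall u, own v u ==> [exists w, bare u w && plain w]]]].
pose N (T : {set G}) := [set zone w | w in [set w | plain w & [exists u in T, bare u w]]].
have XP T : T \in X -> exists v, [/\ plain v, T = zone v &
    forall u, own v u -> exists2 w, bare u w & plain w].
  case/imsetP=> v; rewrite inE => /andP[pv /forallP h] ->; exists v; split=> // u vu.
  by have /existsP[w /andP[]] := implyP (h u) vu; exists w.
have [|hf [hinj hN]] := @hall _ _ (set0 : {set G}) N X.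
  move=> S /subsetP sSX; set W := \bigcup_(i in S) N i.
  have card3 (P : {set {set G}}) : (forall T, T \in P -> exists2 v, plain v & T = zone v) ->
      \sum_(T in P) #|T| = #|P| * 3.
    move=> h; rewrite -sum_nat_const; apply: eq_bigr => T /h[v pv ->]; exact: card_zone.
  have SP T : T \in S -> exists2 v, plain v & T = zone v.
    by move=> /sSX/XP[v [pv E _]]; exists v.
  have WP T : T \in W -> exists2 v, plain v & T = zone v.
    case/bigcupP=> T' _ /imsetP[w]; rewrite inE => /andP[pw _] ->; by exists w.
  have tS : trivIset S.
    apply/trivIsetP=> _ _ /SP[v pv ->] /SP[v' pv' ->].
    apply: contraNT => /pred0Pn[y /=]; rewrite !inE => /andP[vy v'y].
    by rewrite (zone_plain pv vy) (zone_plain pv' v'y).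
  rewrite -(leq_pmul2r (isT : 0 < 3)) -(card3 S SP) -(card3 W WP) (eqP tS).
  apply: leq_trans (leq_card_cover W).
  have /fin_all_exists[g gP] : forall u, exists w, u \in cover S -> bare u w && plain w.
    move=> u; have [|nu] := boolP (u \in cover S); last by exists u.
    case/bigcupP=> T /sSX/XP[v [pv -> h]]; rewrite inE => /h[w b pw].
    by exists w => _; rewrite b.
  have ginj : {in cover S &, injective g}.
    move=> u u' /gP/andP[b pw] /gP/andP[b' _] E.
    apply: (bare_unique (plain_intri pw)); first by rewrite bareC; exact: b.
    by rewrite bareC E.
  rewrite -(card_in_imset ginj); apply: subset_leq_card.
  apply/subsetP=> _ /imsetP[u uS ->]; have /andP[b pw] := gP u uS.
  apply/bigcupP; exists (zone (g u)); last by rewrite inE ownxx.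
  case/bigcupP: uS => T ST uT; apply/bigcupP; exists T => //; apply: imset_f.
  by rewrite inE pw; apply/exists_inP; exists u.
have /fin_all_exists[pk pkP] : forall T : {set G}, exists v, forall u, plain u -> T = zone u ->
    own u v /\ forall s, bare v s -> plain s -> T \in X /\ zone s = hf T.
  move=> T; have [[u0 [pu0 E0]]|no] := classic (exists u, plain u /\ T = zone u); last first.
    by exists x0 => u pu E; case: no; exists u.
  have [TX|nTX] := boolP (T \in X).
    have /imsetP[w] := hN T TX; rewrite inE => /andP[pw /exists_inP[u' Tu' b]] E.
    exists u' => u pu ETu; split; first by rewrite ETu inE in Tu'.
    move=> s bs ps; split=> //; rewrite E; congr zone.
    apply: bare_unique bs b; apply: own_intri (plain_intri pu) _.
    by rewrite ETu inE in Tu'.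
  have [u' u0u' no] : exists2 u', own u0 u' & forall s, bare u' s -> ~~ plain s.
    apply: NNPP => nex; case/negP: nTX; rewrite E0; apply: imset_f; rewrite inE pu0.
    apply/forallP=> u; apply/implyP=> u0u; apply: contraT => /existsPn nw; case: nex.
    by exists u => // s b; have := nw s; rewrite b.
  exists u' => u pu ETu; split; last by move=> s /no/negP.
  have Tu' : u' \in T by rewrite E0 inE.
  by rewrite ETu inE in Tu'.

pose first m := mid m && [forall c, mid c && tri m c ==> (enum_rank m < enum_rank c)].
have pk_own u : plain u -> own u (pk (zone u)).
  by move=> pu; have [] := pkP (zone u) u pu erefl.
have first_exists m : mid m -> exists m', [/\ first m', mid m' & forall v, own m v = own m' v].
  move=> mm; have [c [mc tmc eqo uni]] := twin mm; have [c' [mc' tcc' eqo' uni']] := twin mc.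
  have Em : m = c' by apply: uni'; rewrite // triC.
  case: (ltngtP (enum_rank m) (enum_rank c)) => [lt|lt|/val_inj/enum_rank_inj E].
  - exists m; split=> //; rewrite /first mm; apply/forallP=> y; apply/implyP=> /andP[my tmy].
    by rewrite (uni y).
  - exists c; split=> //; rewrite /first mc; apply/forallP=> y; apply/implyP=> /andP[my tmy].
    by rewrite (uni' y) // -Em.
  - by rewrite E tri_irr in tmc.
have first_unique m m' v : first m -> first m' -> own m v -> own m' v -> m = m'.
  move=> /andP[mm fm] /andP[mm' fm'] mv m'v.
  have [c [mc tmc eqo uni]] := twin mm.
  have conc : own m m' -> m = m'.
    move/predU1P=> [//|tmm'].
    have := implyP (forallP fm m'); rewrite mm' tmm' => /(_ isT) lt1.
    have := implyP (forallP fm' m); rewrite mm triC tmm' => /(_ isT).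
    by rewrite ltnNge (ltnW lt1).
  case/predU1P: m'v => [E|m'v]; first by apply: conc; rewrite E.
  case/predU1P: (mv) => [E|tmv]; first by apply: conc; rewrite E tri_own // triC.
  have cv : own c v by rewrite -eqo.
  case/predU1P: cv => [E|tcv].
    by apply: conc; rewrite eqo E ownC tri_own.
  have [mv'|nmv] := boolP (mid v).
    have [z [_ _ _ uv]] := twin mv'.
    by rewrite (uv m) 1?triC // (uv m') // triC.
  have tvm : tri v m by rewrite triC.
  have [q [_ _ _ all]] := tri_pair nmv tvm.
  have [E|Eq] : c = m \/ c = q by apply: all; rewrite triC.
    by rewrite E tri_irr in tmc.
  have [//|E] : m' = m \/ m' = q by apply: all; rewrite triC.
  by apply: conc; rewrite E -Eq tri_own.
have memD v : (v \in [set m | first m] :|: [set v | plain v & pk (zone v) == v]) ->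
    first v \/ plain v /\ pk (zone v) = v.
  by rewrite !inE => /orP[|/andP[pv /eqP]]; [left|right].
exists ([set m | first m] :|: [set v | plain v & pk (zone v) == v]); split.
  split.
  - by move=> v /memD[/andP[/mid_intri]|[/plain_intri]].
  - move=> v iv; have [pv|npv] := boolP (plain v).
      have vy := pk_own v pv; exists (pk (zone v)); last by rewrite ownC.
      by rewrite !inE (plain_own_plain pv vy) -(zone_plain pv vy) eqxx orbT.
    have [m vm mm] := nplainP iv npv; have [m' [fm' _ eqo]] := first_exists m mm.
    by exists m'; rewrite ?inE ?fm' // -eqo ownC.
  - move=> y z v /memD[fy|[py Ey]] /memD[fz|[pz Ez]] yv zv.
    + exact: first_unique fy fz yv zv.
    + by have /andP[my _] := fy; have := mid_nplain my yv; rewrite (plain_own_plain pz zv).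
    + by have /andP[mz _] := fz; have := mid_nplain mz zv; rewrite (plain_own_plain py yv).
    + by rewrite -Ey -Ez (zone_plain py yv) (zone_plain pz zv).
have plainD x s : x \in [set m | first m] :|: [set v | plain v & pk (zone v) == v] ->
    bare x s -> plain x /\ pk (zone x) = x.
  by move=> /memD[/andP[mx _]|//] b; case: (mid_bare mx b).
move=> x s t y Dx Dy bxs tst bty.
have [px Ex] := plainD x s Dx bxs.
have [byt bsx] : bare y t /\ bare s x by rewrite bareC bty bareC bxs.
have [py Ey] := plainD y t Dy byt.
have ps : plain s.
  apply: contraT => nps.
  have nms : ~~ mid s by apply/negP=> ms; exact: mid_bare ms bsx.
  by case: (mid_bare (diamond_end_mates nps nms tst) bty).
have pt := plain_tri ps tst.
have [_ /(_ s)] := pkP (zone x) x px erefl; rewrite Ex => /(_ bxs ps)[Xx hx].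
have [_ /(_ t)] := pkP (zone y) y py erefl; rewrite Ey => /(_ byt pt)[Xy hy].
rewrite -Ex -Ey; congr pk; apply: hinj => //.
by rewrite -hx -hy; apply: zone_plain ps (tri_own tst).
Qed.

(** * Moving a pick *)

Lemma nplain_bare_mates w u t : ~~ plain w -> bare w u -> tri w t -> mid t.
Proof.
move=> npw bwu; apply: diamond_end_mates => //.
by apply/negP=> mw; apply: mid_bare mw bwu.
Qed.

Lemma mindeg2_two (K : {set G}) v : min_degree2 (@adj G) K -> v \in K ->
  exists a b, [/\ a \in K, b \in K, adj v a, adj v b & a != b].
Proof.
move=> /forall_inP mK /mK /card_gt1P[a [b []]]; rewrite !inE => /andP[Ka va] /andP[Kb vb] ab.
by exists a, b.
Qed.

Section Core.
Variables D K : {set G}.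
Hypotheses (perfD : perfect D) (mK : min_degree2 (@adj G) K) (dKD : forall v, v \in K -> v \notin D).

Lemma core_owner z : z \in K -> in_triangle z -> exists2 o, o \in D & tri z o /\ o \notin K.
Proof.
move=> Kz iz; have [o Do oz] := perf_owner perfD iz.
have no : o \notin K by apply: contraL Do; apply: dKD.
exists o => //; split=> //; case/predU1P: oz => [E|]; last by rewrite triC.
by rewrite E Kz in no.
Qed.

(** In a set [K] of minimum degree 2 that avoids the picks every vertex has at most
    one neighbour outside [K], namely its owner; in particular all its bare edges
    stay in [K]. *)
Lemma core_exit z q : z \in K -> adj z q -> q \notin K -> tri z q /\ q \in D.
Proof.
move=> Kz zq nKq; have [a [b [Ka Kb za zb ab]]] := mindeg2_two mK Kz.
have neq v r : v \in K -> r \notin K -> v != r by move=> Kv; apply: contraNneq => <-.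
have [iz|nz] := boolP (in_triangle z).
  have [o Do [zo nKo]] := core_owner Kz iz.
  case: (nbr3 za zb (tri_adj zo) ab (neq a o Ka nKo) (neq b o Kb nKo) zq) => E.
  - by rewrite E Ka in nKq.
  - by rewrite E Kb in nKq.
  - by rewrite E.
by case: (nontri_deg2 nz za zb zq ab) => E; rewrite E ?Ka ?Kb in nKq.
Qed.

Lemma core_degree z : z \in K -> #|[set y in K | adj z y]| = 2.
Proof.
move=> Kz; apply/eqP; rewrite eqn_leq; apply/andP; split; last by have /forall_inP := mK; apply.
rewrite leqNgt; apply/negP=> /card_gt2P[a [b [c [[]]]]]; rewrite !inE.
move=> /andP[Ka za] /andP[Kb zb] /andP[Kc zc] [ab bc ca].
have [iz|nz] := boolP (in_triangle z).
  have [o Do [zo nKo]] := core_owner Kz iz.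
  have ac : a != c by rewrite eq_sym.
  case: (nbr3 za zb zc ab ac bc (tri_adj zo)) => E; rewrite E ?Ka ?Kb ?Kc // in nKo.
by case: (nontri_deg2 nz za zb zc ab) => E; rewrite E ?eqxx in ca bc.
Qed.
End Core.

Definition cores D := [set S : {set G} | min_degree2 (@adj G) S & [disjoint S & D]].

Lemma coresP D S : reflect (min_degree2 (@adj G) S /\ forall v, v \in S -> v \notin D) (S \in cores D).
Proof.
rewrite inE; apply: (iffP andP) => -[mS dS]; split=> //.
  by move=> v Sv; rewrite (disjointFr dS).
by rewrite disjoint_subset; apply/subsetP=> v /dS.
Qed.

(** The pick [y] of the triangle [u, y, q] moves to [u].  The picks stay separated
    because [w] is not in a plain triangle.  The set [K] is lost, and no set [S]
    of minimum degree 2 is gained: such an [S] would contain [y], hence [q], and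
    in [K :&: S] the vertex [q] would have degree 1 and all others degree 2,
    against the handshake lemma. *)
Lemma shift D K u w : perfect D -> separated D -> K \in cores D ->
  u \in K -> w \in K -> plain u -> ~~ plain w -> adj u w ->
  exists D', [/\ perfect D', separated D' & #|cores D'| < #|cores D|].
Proof.
move=> pD sD KD Ku Kw pu npw uw; have /coresP[mK dK] := KD.
have iu := plain_intri pu.
have [y Dy [uy nKy]] := core_owner pD dK Ku iu.
have buw : bare u w by case: (adj_cases uw) => // /(plain_tri pu); rewrite (negPf npw).
have bwu : bare w u by rewrite bareC.
have ouy v : own u v = own y v by apply: plain_own.
have uyn : u != y by apply: adj_neq; apply: tri_adj.
set D' := u |: (D :\ y).
have memD' v : v \in D' -> v = u \/ v != y /\ v \in D.
  by move/setU1P=> [->|/setD1P]; [left|right].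
have pD' : perfect D'.
  split.
  - by move=> v /memD'[->//|[_ /(perf_intri pD)]].
  - move=> v iv; have [z Dz zv] := perf_owner pD iv.
    have [E|zy] := eqVneq z y; first by exists u; [rewrite !inE eqxx | rewrite ouy -E].
    by exists z; rewrite // !inE zy Dz orbT.
  - move=> x z v /memD'[->|[xy Dx]] /memD'[->|[zy Dz]] //; rewrite ?ouy => xv zv.
    + by rewrite (perf_unique pD Dz Dy zv xv) eqxx in zy.
    + by rewrite (perf_unique pD Dx Dy xv zv) eqxx in xy.
    + exact: (perf_unique pD Dx Dz xv zv).
have sD' : separated D'.
  move=> x s t z /memD'[->|[xy Dx]] /memD'[->|[zy Dz]] // bs st tz.
  - rewrite (bare_unique iu bs buw) in st.
    by case: (mid_bare (nplain_bare_mates npw bwu st) tz).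
  - have bs' : bare s x by rewrite bareC.
    have ut : bare u t by rewrite bareC.
    rewrite (bare_unique iu ut buw) triC in st.
    by case: (mid_bare (nplain_bare_mates npw bwu st) bs').
  - exact: sD bs st tz.
exists D'; split=> //; apply: proper_card.
have nyS S : S \in cores D' -> y \notin S.
  move=> /coresP[mS dS]; apply/negP=> Sy.
  have Su : u \notin S by apply/negP=> /dS; rewrite !inE eqxx.
  pose A := K :&: S.
  have [q [uq yq yq' mates]] := tri_pair (plain_nmid pu (ownxx u)) uy.
  have [qu qy] : tri q u /\ tri q y by rewrite triC uq triC yq.
  have auq := tri_adj uq.
  have aqu := tri_adj qu; have aqy := tri_adj qy.
  have Kq : q \in K.
    apply: contraT => nKq; have [_ Dq] := core_exit pD mK dK Ku auq nKq.
    by have := perf_unique pD Dq Dy (tri_own qu) (tri_own (etrans (triC _ _) uy));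
       move=> E; rewrite E eqxx in yq'.
  have Sq : q \in S.
    apply: contraT => nSq; have [_ Dq] := core_exit pD' mS dS Sy (tri_adj yq) nSq.
    have Du : u \in D' by rewrite !inE eqxx.
    have E := perf_unique pD' Dq Du (tri_own qu) (ownxx u).
    by rewrite E tri_irr in uq.
  have degA z : z \in A -> z != q -> #|[set v in A | adj z v]| = 2.
    move=> /setIP[Kz Sz] zq; rewrite -(core_degree pD mK dK Kz).
    apply: eq_card => v; rewrite !inE; case zv: (adj z v); rewrite ?andbF // !andbT.
    apply: andb_idr => Kv; apply: contraT => nSv.
    have [tzv D'v] := core_exit pD' mS dS Sz zv nSv.
    have [E|[_ Dv]] := memD' v D'v; last by have := dK v Kv; rewrite Dv.
    have tuz : tri u z by rewrite triC -E.
    by case: (mates z tuz) => E'; [rewrite -E' Kz in nKy|rewrite E' eqxx in zq].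
  (* r is the end of the bare edge of q *)
  have degq : #|[set v in A | adj q v]| = 1.
    have [a [b [Ka Kb qa qb ab]]] := mindeg2_two mK Kq.
    have [r [Kr qr ru ry]] : exists r, [/\ r \in K, adj q r, r != u & r != y].
      have ny v : v \in K -> v != y by apply: contraTneq => ->.
      have [E|au] := eqVneq a u; last by exists a; split=> //; exact: ny.
      by exists b; split=> //; [rewrite -E eq_sym | exact: ny].
    have all v : adj q v -> [\/ v = u, v = y | v = r].
      by apply: (nbr3 aqu aqy qr uyn); rewrite eq_sym.
    have Sr : r \in S.
      have [a' [b' [Sa Sb qa' qb' ab']]] := mindeg2_two mS Sq.
      have nu v : v \in S -> v != u by apply: contraTneq => ->.
      have aux v : v \in S -> adj q v -> v != y -> r \in S.
        move=> Sv /all[] E vy; [by have := nu v Sv; rewrite E eqxx | by rewrite E eqxx in vy | by rewrite -E].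
      have [E|ay] := eqVneq a' y; last exact: aux Sa qa' ay.
      by apply: (aux b') => //; rewrite -E eq_sym.
    rewrite -(cards1 r); apply: eq_card => v; rewrite !inE; apply/idP/eqP.
      by case/andP=> /andP[Kv Sv] /all[] // E; [rewrite -E Sv in Su|rewrite -E Kv in nKy].
    by move=> ->; rewrite Kr Sr qr.
  have Aq : q \in A by rewrite inE Kq Sq.
  have := handshake (@adj_sym G) (@adj_irrefl G) A.
  rewrite (bigD1 q) //= degq (eq_bigr (fun=> 2)) => [|z /andP[Az zq]]; last exact: degA.
  by rewrite sum_nat_const oddD oddM andbF.
apply/properP; split.
  apply/subsetP=> S SD'; have /coresP[mS dS] := SD'; apply/coresP; split=> // v Sv.
  apply/negP=> Dv; have := dS v Sv; rewrite !inE negb_or => /andP[_].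
  by rewrite Dv andbT negbK => /eqP E; have := nyS S SD'; rewrite -E Sv.
exists K => //; apply/negP=> /coresP[_ /(_ u Ku)].
by rewrite !inE eqxx.
Qed.

Lemma exists_shift_minimal (x0 : G) : exists D, [/\ perfect D, separated D &
  forall K u w, K \in cores D -> u \in K -> w \in K -> plain u -> ~~ plain w -> ~~ adj u w].
Proof.
have [D0 [pD0 sD0]] := exists_perfect_separated x0.
have [n] := ubnP #|cores D0|; elim: n => // n IHn in D0 pD0 sD0 *; rewrite ltnS => le.
have [[K [u [w [KD Ku Kw pu [npw uw]]]]]|no] := classic (exists K u w,
  [/\ K \in cores D0, u \in K, w \in K, plain u & ~~ plain w /\ adj u w]).
  have [D1 [pD1 sD1 lt]] := shift pD0 sD0 KD Ku Kw pu npw uw.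
  by apply: (IHn D1) => //; apply: leq_trans lt le.
exists D0; split=> // K u w KD Ku Kw pu npw; apply/negP=> uw.
by apply: no; exists K, u, w.
Qed.

(** * Four pairwise linked triangles *)

Lemma card_zone_le x : #|zone x| <= #|[set y | tri x y]|.+1.
Proof.
have -> : zone x = x |: [set y | tri x y] by apply/setP=> y; rewrite !inE eq_sym.
by apply: leq_trans (leq_card_setU _ _).1 _; rewrite cards1.
Qed.

(** The two middle vertices of a diamond are not exits. *)
Lemma three_exits_nmid x : #|exits x| = 3 -> ~~ mid x.
Proof.
move=> E3; apply/negP=> mx; have [c [mc tc _ _]] := twin mx.
have : #|exits x| <= #|zone x :\ x :\ c|.
  apply/subset_leq_card/subsetP=> v; rewrite !inE => /andP[-> /existsP[w b]]; rewrite andbT.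
  by apply/andP; split; apply/eqP=> E; rewrite E in b; [apply: mid_bare mc b|apply: mid_bare mx b].
have := card_zone_le x; rewrite (cardsD1 x (zone x)) (cardsD1 c (_ :\ _)) E3 !inE ownxx.
rewrite (tri_own tc) andbT eq_sym (adj_neq (tri_adj tc)) !add1n !ltnS => le1 le2.
have := leq_ltn_trans le2 le1; apply/negP; rewrite -leqNgt.
apply: leq_trans (deg3 x); apply/subset_leq_card/subsetP=> y; rewrite !inE.
exact: tri_adj.
Qed.

Lemma three_exits_zone x : #|exits x| = 3 -> zone x = exits x.
Proof.
move=> E3; have nmx := three_exits_nmid E3; apply/esym/eqP; rewrite eqEcard E3.
apply/andP; split; first by apply/subsetP=> v; rewrite !inE => /andP[].
by apply: leq_trans (card_zone_le x) _; move: nmx; rewrite /mid -leqNgt.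
Qed.

Lemma three_exits_tri x u v : #|exits x| = 3 -> own x u -> own x v -> u != v -> tri u v.
Proof.
move=> E3; have nmx := three_exits_nmid E3.
move=> /predU1P[<-|xu] /predU1P[<-|xv] uv; rewrite ?eqxx // in uv *; first by rewrite triC.
have [q [_ uq _ all]] := tri_pair nmx xu.
by case: (all v xv) => E; [rewrite E eqxx in uv|rewrite E].
Qed.

(** [x i] is a vertex of the triangle [i], and [s i j] is the vertex of this
    triangle at which the link to the triangle [j] starts.  In [q_all] the
    second case is that of the inner vertices of the links: as there are at most
    two of them on a link, each is adjacent to an end. *)
Record quartet (x : 'I_4 -> G) (s : 'I_4 -> 'I_4 -> G) : Prop := Quartet {
  q_own : forall i j, i != j -> own (x i) (s i j);
  q_link : forall i j, i != j -> link (s i j) (s j i);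
  q_inj : forall i j k, i != j -> i != k -> s i j = s i k -> j = k;
  q_zone : forall i v, own (x i) v -> exists2 j, i != j & v = s i j;
  q_tri : forall i j k, i != j -> i != k -> j != k -> tri (s i j) (s i k);
  q_sep : forall i j v, own (x i) v -> own (x j) v -> i = j;
  q_owntri : forall i u v, own (x i) u -> tri u v -> own (x i) v;
  q_all : forall v, (exists i, own (x i) v) \/
                    (~~ in_triangle v /\ exists i j, i != j /\ adj (s i j) v)
}.

Hypothesis Gconn : connected G.

Lemma connected_closed (C : G -> Prop) v0 : C v0 ->
  (forall u w, C u -> adj u w -> C w) -> forall v, C v.
Proof.
move=> Cv0 cl v; have /connectP[p pp ->] := Gconn v0 v.
by elim: p v0 Cv0 pp => //= u p IHp v0 Cv0 /andP[vu]; apply: IHp; apply: cl vu.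
Qed.

(** Four picks in pairwise conflict use up the three exits of each of their
    components, so the components are triangles, and the union of the triangles
    and the links is closed under adjacency. *)
Lemma clique_quartet D (x : 'I_4 -> G) : perfect D -> separated D ->
  (forall i, x i \in D) -> injective x -> (forall i j, i != j -> near (x i) (x j)) ->
  exists s, quartet x s.
Proof.
move=> pD sD Dx xinj nx.
have sep i j v : own (x i) v -> own (x j) v -> i = j.
  by move=> iv jv; apply/xinj/(perf_unique pD (Dx i) (Dx j) iv jv).
have owntri i u v : own (x i) u -> tri u v -> own (x i) v := own_tri pD (Dx i).
have /fin_all_exists[s0 s0P] : forall p : 'I_4 * 'I_4, exists u, p.1 != p.2 ->
    own (x p.1) u /\ exists f, own (x p.2) f /\ link u f.
  case=> i j; have [ij|] := boolP (i != j); last by exists (x i).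
  have xij : x i != x j by apply: contraNneq ij => /xinj->.
  have [u [f [xu xf l _]]] := near_link pD sD (Dx i) (Dx j) xij (nx i j ij).
  by exists u => _; split=> //; exists f.
pose s i j := s0 (i, j).
have sP i j : i != j -> own (x i) (s i j) /\ exists f, own (x j) f /\ link (s i j) f.
  exact: (s0P (i, j)).
have sown i j : i != j -> own (x i) (s i j) by move/sP=> [].
have sinj i j k : i != j -> i != k -> s i j = s i k -> j = k.
  move=> ij ik E; have [_ [f [xf l]]] := sP i j ij; have [_ [f' [xf' l']]] := sP i k ik.
  by rewrite -E in l'; rewrite -(link_fun l l') in xf'; apply: sep xf xf'.
have imE i : [set s i j | j in [set~ i]] = exits (x i) /\ #|exits (x i)| = 3.
  have c3 : #|[set s i j | j in [set~ i]]| = 3.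
    rewrite card_in_imset; first by rewrite cardsC1 card_ord.
    by move=> j k; rewrite !inE ![_ == i]eq_sym; apply: sinj.
  suff E : [set s i j | j in [set~ i]] = exits (x i) by split=> //; rewrite -E.
  apply/eqP; rewrite eqEcard c3 card_exits andbT; apply/subsetP=> v /imsetP[j].
  rewrite !inE eq_sym => ij {v}->; rewrite sown //.
  by have [_ [f [_ /link_first[w b]]]] := sP i j ij; apply/existsP; exists w.
have zoneE i v : own (x i) v -> exists2 j, i != j & v = s i j.
  have [E1 E3] := imE i; move=> xv; have : v \in zone (x i) by rewrite inE.
  by rewrite three_exits_zone // -E1 => /imsetP[j]; rewrite !inE eq_sym; exists j.
have slink i j : i != j -> link (s i j) (s j i).
  move=> ij; have [xs [f [xf l]]] := sP i j ij; have [k jk Ef] := zoneE j f xf.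
  have [_ [f' [xf' l']]] := sP j k jk; rewrite -Ef in l'.
  rewrite -(link_fun (link_sym l) l') in xf'.
  by rewrite -(sep _ _ _ xs xf') in Ef; rewrite -Ef.
exists s; split=> //.
  move=> i j k ij ik jk; have [_ E3] := imE i.
  by apply: (three_exits_tri E3); rewrite ?sown //; apply: contraNneq jk => /sinj->.
apply: (@connected_closed _ (x ord0)); first by left; exists ord0; exact: ownxx.
move=> u w [[i xu]|[nu [i [j [ij au]]]]] uw.
  case: (adj_cases uw) => b; first by left; exists i; apply: owntri b.
  have [j ij E] := zoneE i u xu; rewrite {}E in uw b xu.
  have [is_ _] := link_intri (slink i j ij).
  case: (slink i j ij) => [_ if_ b'|v _ _ nv sv vf _|v v' _ _ nv nv' sv vv' vf].
  - by left; exists j; rewrite (bare_unique is_ b b') sown // eq_sym.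
  - by right; rewrite (bare_unique is_ b (nontri_bare nv sv)); split=> //; exists i, j.
  - by right; rewrite (bare_unique is_ b (nontri_bare nv sv)); split=> //; exists i, j.
have bu := nontri_bare nu au.
have ua : adj u (s i j) by rewrite adjC.
have ji : j != i by rewrite eq_sym.
case: (slink i j ij) => [is_ if_ b'|v is_ _ nv sv vf sf|v v' is_ _ nv nv' sv vv' vf].
- by rewrite (bare_unique is_ bu b') if_ in nu.
- rewrite (bare_unique is_ (nontri_bare nv sv) bu) in vf.
  case: (nontri_deg2 nu ua vf uw sf) => ->; [left; exists i|left; exists j]; exact: sown.
- rewrite (bare_unique is_ (nontri_bare nv sv) bu) in vv'.
  have sv' : s i j != v' by apply: intri_neq.
  case: (nontri_deg2 nu ua vv' uw sv') => ->; first by left; exists i; apply: sown.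
  by right; split=> //; exists j, i; rewrite adjC.
Qed.

Section Quartet.
Variables (x : 'I_4 -> G) (s : 'I_4 -> 'I_4 -> G).
Hypothesis Q : quartet x s.

Lemma q_unlinked i j k l : i != j -> k != l -> own (x i) (s k l) -> i = k.
Proof. by move=> ij kl ikl; apply: q_sep Q _ _ _ ikl (q_own Q kl). Qed.

Lemma quartet_all_intri v : (forall i j, i != j -> bare (s i j) (s j i)) ->
  exists i j, i != j /\ v = s i j.
Proof.
move=> allb; case: (q_all Q v) => [[i /(q_zone Q)[j ij ->]]|[nv [i [j [ij av]]]]].
  by exists i, j.
have [is_ if_] := link_intri (q_link Q ij).
have E := bare_unique is_ (nontri_bare nv av) (allb i j ij).
by rewrite E if_ in nv.
Qed.

Lemma quartet_adj i j k l : (forall i j, i != j -> bare (s i j) (s j i)) ->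
  i != j -> k != l ->
  adj (s i j) (s k l) = ((i == k) && (j != l)) || ((i == l) && (j == k)).
Proof.
move=> allb ij kl; have ji : j != i by rewrite eq_sym.
have [is_ _] := link_intri (q_link Q ij).
apply/idP/idP=> [a|].
  have [E|ik] := eqVneq i k.
    apply/orP; left; apply: contraTneq a => <-; by rewrite E adj_irrefl.
  case: (adj_cases a) => [t|b].
    have := q_owntri Q (q_own Q ij) t.
    by move/(q_unlinked ij kl) => E; rewrite E eqxx in ik.
  have E := bare_unique is_ b (allb i j ij).
  have Ej : j = k by apply: q_unlinked kl _ => //; rewrite ?E; [exact: ji|exact: q_own].
  rewrite -{}Ej in E kl *; rewrite eqxx andbT.
  by rewrite (q_inj Q kl ji E) eqxx.
case/orP=> /andP[/eqP Ei].
  by rewrite -{}Ei in kl * => jl; apply: tri_adj (q_tri Q ij kl jl).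
by move=> /eqP Ej; rewrite -Ei -Ej; apply/bare_adj/allb.
Qed.

(** The ordinal [n] of [graphH] lies in the triangle number [nth 0 H_triangle n] and has
    its bare edge to the triangle number [nth 0 H_towards n]. *)
Definition H_triangle := [:: 0; 0; 1; 1; 2; 2; 3; 3; 0; 1; 2; 3].
Definition H_towards := [:: 3; 1; 0; 2; 1; 3; 2; 0; 2; 3; 0; 1].

Lemma quartet_graphH : (forall i j, i != j -> bare (s i j) (s j i)) -> isomorphic G graphH.
Proof.
move=> allb.
pose tr (n : nat) := nth 0 H_triangle n; pose tw (n : nat) := nth 0 H_towards n.
have check (P : nat -> nat -> bool) :
    all (fun m => all (P m) (iota 0 12)) (iota 0 12) -> forall m n, m < 12 -> n < 12 -> P m n.
  move=> /allP h m n lm ln; have lm' : m \in iota 0 12 by rewrite mem_iota.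
  by have /allP := h m lm'; apply; rewrite mem_iota.
pose a (m : 'I_12) : 'I_4 := inord (tr m); pose b (m : 'I_12) : 'I_4 := inord (tw m).
have lt4 (m : 'I_12) : (tr m < 4) && (tw m < 4) && (tr m != tw m).
  by apply: (check (fun m _ => (tr m < 4) && (tw m < 4) && (tr m != tw m)) isT m 0).
have va m : val (a m) = tr m by rewrite /= inordK //; case/andP: (lt4 m) => /andP[].
have vb m : val (b m) = tw m by rewrite /= inordK //; case/andP: (lt4 m) => /andP[].
have ab m : a m != b m by rewrite -val_eqE va vb; case/andP: (lt4 m).
pose g m := s (a m) (b m).
have gadj m n : adj (g m) (g n) = graphH_adj m n.
  rewrite quartet_adj // -!val_eqE !va !vb; apply/eqP.
  apply: (check (fun m n => (((tr m == tr n) && (tw m != tw n)) || ((tr m == tw n) && (tw m == tr n))) ==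
   (((m.+1, n.+1) \in graphH_edges) || ((n.+1, m.+1) \in graphH_edges))) _ m n (ltn_ord m) (ltn_ord n)).
  by vm_compute.
have ginj : injective g.
  move=> m n E; have Ea : a m = a n by apply: (q_sep Q (v := g m)); [exact: q_own|rewrite E; exact: q_own].
  have Eb : b m = b n.
    by apply: (q_inj Q (i := a m)); rewrite ?ab //; [rewrite Ea ab | rewrite -/(g m) E /g Ea].
  apply/val_inj/eqP; move/(congr1 val): Ea; move/(congr1 val): Eb; rewrite !va !vb => /eqP Eb /eqP Ea.
  have := check (fun m n => (tr m == tr n) && (tw m == tw n) ==> (m == n)) isT m n (ltn_ord m) (ltn_ord n).
  by rewrite Ea Eb.
have gsurj v : exists m, g m = v.
  have [i [j [ij ->]]] := quartet_all_intri v allb.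
  have : has (fun m => (tr m == i) && (tw m == j)) (iota 0 12).
    by case: i j ij => [[|[|[|[|//]]]] ?] [[|[|[|[|//]]]] ?].
  case/hasP=> m; rewrite mem_iota /= => lm /andP[/eqP Ei /eqP Ej]; exists (Ordinal lm).
  by congr s; apply: val_inj; rewrite ?va ?vb.
have /fin_all_exists[f fP] := gsurj.
exists f; split; last by move=> u v; rewrite -[in LHS](fP u) -[in LHS](fP v) gadj.
by exists g => [v|m]; [exact: fP | apply/ginj/fP].
Qed.
End Quartet.

(** * From colourings to packing colourings *)

Lemma nearC x y : near x y = near y x.
Proof.
rewrite /near adjC; congr [|| _, _ | _].
  by apply: eq_existsb => a; rewrite andbC (adjC a y) (adjC x a).
apply/existsP/existsP=> -[a /existsP[b /and3P[xa ab bz]]];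
by exists b; apply/existsP; exists a; apply/and3P; split; rewrite adjC.
Qed.

Lemma path_near x p : path (@adj G) x p -> size p <= 3 -> x != last x p -> near x (last x p).
Proof.
case: p => [|a [|b [|c [|//]]]] /=; first by rewrite eqxx.
- by rewrite andbT /near => ->.
- by rewrite /near => /and3P[xa ab _] _ _; apply/or3P/Or32/existsP; exists a; rewrite xa.
- rewrite /near => /and4P[xa ab bc _] _ _; apply/or3P/Or33/existsP; exists a; apply/existsP.
  by exists b; rewrite xa ab.
Qed.

Lemma packing_from_coloring D (c : G -> 'I_3) :
  {in D &, forall x y, x != y -> near x y -> c x != c y} ->
  bipartite_on (@adj G) (~: D) -> packing_colorable [tuple 1; 1; 3; 3; 3] G.
Proof.
move=> cP [f fP].
pose F v : nat := if v \in D then (c v).+2 else f v.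
have ltF v : F v < 5.
  by rewrite /F; case: ifP => _; [have := ltn_ord (c v)|case: (f v)].
exists (fun i : 'I_5 => [set v | F v == i]); split=> [x|i x y].
  exists (Ordinal (ltF x)); split=> [|j]; first by rewrite inE.
  by rewrite inE => /eqP E; apply: val_inj.
rewrite !inE => /eqP Fx /eqP Fy /eqP xy d [[p [pp pl ps]] _]; rewrite ltnNge; apply/negP=> led.
have SE : tnth [tuple 1; 1; 3; 3; 3] i = if i < 2 then 1 else 3.
  by rewrite (tnth_nth 0); case: (i) => -[|[|[|[|[|//]]]]].
have memF v : (v \in D) = (1 < F v) by rewrite /F; case: ifP => // _; case: (f v).
have [Dx|nDx] := boolP (x \in D).
  have Dy : y \in D by rewrite memF Fy -Fx -memF.
  have i2 : (i < 2) = false by rewrite ltnNge -Fx -memF Dx.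
  rewrite SE i2 in led; have := cP x y Dx Dy xy; rewrite -pl.
  have -> : c (last x p) = c x.
    by apply/val_inj/eqP; rewrite pl -eqSS -eqSS; move: Fx; rewrite -Fy /F Dx Dy => ->.
  by rewrite eqxx => h; apply: notF; apply: h; apply: path_near; rewrite ?ps ?pl.
have nDy : y \notin D by rewrite memF Fy -Fx -memF.
have i2 : i < 2 by rewrite ltnNge -Fx -memF.
rewrite SE i2 -ps in led.
have axy : adj x y.
  case: (p) pp pl led => [|a [|//]] /=; first by move=> _ E; rewrite E eqxx in xy.
  by rewrite andbT => xa <-.
have := fP x y; rewrite !inE => /(_ nDx nDy axy).
by move: Fx; rewrite -Fy /F (negPf nDx) (negPf nDy); case: (f x); case: (f y).
Qed.

Lemma quartet_perm (x : 'I_4 -> G) s (h : 'I_4 -> 'I_4) : quartet x s -> injective h ->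
  quartet (fun i => x (h i)) (fun i j => s (h i) (h j)).
Proof.
move=> [qo ql qi qz qt qs qot qa] hinj; have [h' hK h'K] := injF_bij hinj.
have nh i j : i != j -> h i != h j by rewrite (inj_eq hinj).
split.
- by move=> i j /nh; apply: qo.
- by move=> i j /nh; apply: ql.
- by move=> i j k /nh ij /nh ik /(qi _ _ _ ij ik)/hinj.
- move=> i v /qz[j ij ->]; exists (h' j); last by rewrite h'K.
  by apply: contraNneq ij => ->; rewrite h'K.
- by move=> i j k /nh ij /nh ik /nh jk; apply: qt.
- by move=> i j v iv /(qs _ _ _ iv)/hinj.
- by move=> i; apply: qot.
- move=> v; have [[i iv]|[nv [i [j [ij a]]]]] := qa v; first by left; exists (h' i); rewrite h'K.
  right; split=> //; exists (h' i), (h' j); rewrite !h'K; split=> //.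
  by apply: contraNneq ij => /(can_inj h'K)->.
Qed.

(** Bare edges do not leave [K], by [core_exit]. *)
Lemma core_link D K s f : perfect D -> K \in cores D -> link s f -> s \in K -> f \in K.
Proof.
move=> pD /coresP[mK dK] l Ks.
have step u v : u \in K -> bare u v -> v \in K.
  move=> Ku b; apply: contraT => nKv.
  have [t _] := core_exit pD mK dK Ku (bare_adj b) nKv.
  by rewrite (bare_ntri b) in t.
case: l => [_ _ b|w _ _ nw sw wf _|w w' _ _ nw nw' sw ww' wf]; first exact: step b.
- have Kw := step s w Ks (nontri_bare nw sw).
  by apply: (step w) => //; rewrite bareC; apply: nontri_bare; rewrite // adjC.
- have Kw := step s w Ks (nontri_bare nw sw).
  have Kw' := step w w' Kw (nontri_bare nw' ww').
  by apply: (step w') => //; rewrite bareC; apply: nontri_bare; rewrite // adjC.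
Qed.

Lemma nonbip_core D : ~ bipartite_on (@adj G) (~: D) ->
  exists K, [/\ K \in cores D, ~ bipartite_on (@adj G) K &
    forall K' : {set G}, K' \proper K -> bipartite_on (@adj G) K'].
Proof.
move=> /(min_nonbip (e := @adj G))[K [sK nK mK]]; exists K; split=> //.
apply/coresP; split; first exact: (min_nonbip_mindeg2 (@adj_sym G) (@adj_irrefl G) nK mK).
by move=> v /(subsetP sK); rewrite inE.
Qed.

(** Number the triangles so that the longer link joins 0 and 1, and let the triangle
    [i] pick its exit to [pi i], where [pi] is the cycle 0, 2, 1, 3.  The picks of
    0 and 1 do not start the link between their triangles, so they may share a
    colour, and the other two picks get a colour each.

    The other vertices of the triangle [i] are [t i (rho i)] and [t i (theta i)],
    with [rho] the inverse of [pi].  The link at the first one ends at the pick of [rho i], so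
    this vertex is in no set of minimum degree 2 that avoids the picks; then
    neither is its mate [t i (theta i)], so there is no such set and the rest is
    bipartite. *)
Lemma quartet_long_link (x : 'I_4 -> G) s i0 j0 : quartet x s -> i0 != j0 -> ~~ bare (s i0 j0) (s j0 i0) ->
  packing_colorable [tuple 1; 1; 3; 3; 3] G.
Proof.
pose o0 : 'I_4 := @Ordinal 4 0 isT; pose o1 : 'I_4 := @Ordinal 4 1 isT.
pose o2 : 'I_4 := @Ordinal 4 2 isT; pose o3 : 'I_4 := @Ordinal 4 3 isT.
move=> Q0 ij0 nb0.
have [h hinj [h0 h1]] : exists2 h : 'I_4 -> 'I_4, injective h & h o0 = i0 /\ h o1 = j0.
  pose h1 := tperm o0 i0.
  exists (fun k => h1 (tperm o1 (h1 j0) k)); first by move=> k l /perm_inj/perm_inj.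
  have n0 : h1 j0 != o0 by rewrite -(tpermR o0 i0) (inj_eq perm_inj) eq_sym.
  by split; [rewrite tpermD // ?tpermL // eq_sym | rewrite tpermL tpermK].
have Q := quartet_perm Q0 hinj.
move: Q; set y := (fun i => x (h i)); set t := (fun i j => s (h i) (h j)) => Q.
have nb : ~~ bare (t o0 o1) (t o1 o0) by rewrite /t h0 h1.
pose pi (i : 'I_4) := match val i with 0 => o2 | 1 => o3 | 2 => o1 | _ => o0 end.
pose rho (i : 'I_4) := match val i with 0 => o3 | 1 => o2 | 2 => o0 | _ => o1 end.
pose theta (i : 'I_4) := match val i with 0 => o1 | 1 => o0 | 2 => o3 | _ => o2 end.
pose col (i : 'I_4) : 'I_3 := match val i with 0 => @Ordinal 3 0 isT | 1 => @Ordinal 3 0 isT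
  | 2 => @Ordinal 3 1 isT | _ => @Ordinal 3 2 isT end.
have ind (P : 'I_4 -> Prop) : P o0 -> P o1 -> P o2 -> P o3 -> forall i, P i.
  move=> P0 P1 P2 P3; case=> [[|[|[|[|//]]]] lt].
  - by rewrite (_ : Ordinal lt = o0) //; apply: val_inj.
  - by rewrite (_ : Ordinal lt = o1) //; apply: val_inj.
  - by rewrite (_ : Ordinal lt = o2) //; apply: val_inj.
  - by rewrite (_ : Ordinal lt = o3) //; apply: val_inj.
have npi i : i != pi i by move: i; apply: (ind).
have nrho i : i != rho i by move: i; apply: (ind).
have ntheta i : i != theta i by move: i; apply: (ind).
have npr i : pi i != rho i by move: i; apply: (ind).
have npt i : pi i != theta i by move: i; apply: (ind).
have nrt i : rho i != theta i by move: i; apply: (ind).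
have pirho i : pi (rho i) = i by move: i; apply: (ind).
have piinj : injective pi.
  by apply: (can_inj (g := rho)); apply: (ind).
have four i j : i != j -> [\/ j = pi i, j = rho i | j = theta i].
  by move: i j; apply: (ind); apply: (ind) => // _; by [constructor 1|constructor 2|constructor 3].
pose D := [set t i (pi i) | i : 'I_4].
have Dt i : t i (pi i) \in D by apply: imset_f.
have DP v : v \in D -> exists i, v = t i (pi i) by case/imsetP=> i _ ->; exists i.
have town i v : own (t i (pi i)) v -> own (y i) v.
  move=> /predU1P[<-|tv]; first exact: (q_own Q (npi i)).
  exact: (q_owntri Q (q_own Q (npi i)) tv).
have ownt i v : own (y i) v -> own (t i (pi i)) v.
  case/(q_zone Q)=> j ij ->; have [->|jp] := eqVneq j (pi i); first exact: ownxx.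
  by apply/tri_own/(q_tri Q) => //; rewrite eq_sym.
have lk i j (ij : i != j) := q_link Q ij.
have pD : perfect D.
  split.
  - by move=> v /DP[i ->]; have [] := link_intri (lk i _ (npi i)).
  - move=> v iv; case: (q_all Q v) => [[i iv']|[]]; last by rewrite iv.
    by exists (t i (pi i)); rewrite ?Dt // ownt.
  - by move=> u v w /DP[i ->] /DP[j ->] /town iw /town jw; rewrite (q_sep Q iw jw).
have sD : separated D.
  move=> u a b v /DP[i ->] /DP[j ->] ba tab bb.
  have dir k w : bare (t k (pi k)) w -> in_triangle w -> own (y (pi k)) w.
    move=> b' iw; have [is_ _] := link_intri (lk k _ (npi k)).
    rewrite (link_fun (Link0 is_ iw b') (lk k _ (npi k))).
    by apply: (q_own Q); rewrite eq_sym.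
  have pa := dir i a ba (tri_intri tab).
  have pb : own (y (pi j)) b by apply: dir (tri_intri2 tab); rewrite bareC.
  by rewrite (piinj _ _ (q_sep Q (q_owntri Q pa tab) pb)).
have /fin_all_exists[c cP] : forall v, exists k, forall i, own (y i) v -> k = col i.
  move=> v; have [[i iv]|no] := classic (exists i, own (y i) v).
    by exists (col i) => j jv; rewrite (q_sep Q iv jv).
  by exists ord0 => i iv; case: no; exists i.
have ct i : c (t i (pi i)) = col i by apply/cP/(q_own Q).
have samecol i j : i != j -> col i = col j -> [/\ pi i != j, pi j != i & ~~ bare (t i j) (t j i)].
  by move: i j; apply: (ind); apply: (ind) => //= _ _; split=> //; rewrite bareC.
apply: (@packing_from_coloring D c).
  move=> _ _ /DP[i ->] /DP[j ->] neq near_ij; rewrite !ct; apply/eqP=> Ecol.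
  have ij : i != j by apply: contraNneq neq => ->.
  have [pij pji nbij] := samecol i j ij Ecol.
  have [u [f [/town iu /town jf l alt]]] := near_link pD sD (Dt i) (Dt j) neq near_ij.
  have [k ik Eu] := q_zone Q iu; rewrite Eu in l alt.
  have Ef := link_fun l (lk i k ik).
  have Ek : k = j.
    by apply: (q_sep Q _ jf); rewrite Ef; apply: (q_own Q); rewrite eq_sym.
  rewrite Ef Ek in alt; have ji : j != i by rewrite eq_sym.
  case: alt => [|E|E]; first by rewrite (negPf nbij).
  - by rewrite (q_inj Q ij (npi i) E) eqxx in pij.
  - by rewrite (q_inj Q ji (npi j) E) eqxx in pji.
apply: NNPP => /nonbip_core[K [KD nK _]]; apply: nK.
have [mK dK] := coresP _ _ KD.
have nKpi i : t i (pi i) \notin K by apply/negP=> /dK; rewrite Dt.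
have nKrho i : t i (rho i) \notin K.
  apply/negP=> /(core_link pD KD (lk i _ (nrho i))).
  by rewrite -{2}(pirho i) (negPf (nKpi _)).
have nKtheta i : t i (theta i) \notin K.
  apply/negP=> Kt; have [a [b [Ka Kb ta tb ab]]] := mindeg2_two mK Kt.
  have tp : adj (t i (theta i)) (t i (pi i)).
    by apply/tri_adj/(q_tri Q); rewrite // eq_sym.
  have tr : adj (t i (theta i)) (t i (rho i)).
    by apply/tri_adj/(q_tri Q); rewrite // eq_sym.
  have neq v w : v \in K -> w \notin K -> v != w by move=> Kv; apply: contraNneq => <-.
  have pr : t i (pi i) != t i (rho i).
    by apply: contraNneq (npr i) => /(q_inj Q (npi i) (nrho i))->.
  have := four_nbrs ta tb tp tr; rewrite /= !inE !negb_or ab pr.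
  by rewrite !(neq a _ Ka (nKpi i), neq a _ Ka (nKrho i), neq b _ Kb (nKpi i), neq b _ Kb (nKrho i)).
have nKt i j : i != j -> t i j \notin K by case/four=> ->.
exists xpredT => v w Kv Kw _; exfalso.
case: (q_all Q v) => [[i /(q_zone Q)[j ij E]]|[nv [i [j [ij av]]]]].
  by have := nKt i j ij; rewrite -E Kv.
have va : adj v (t i j) by rewrite adjC.
have [/tri_intri] := core_exit pD mK dK Kv va (nKt i j ij).
by rewrite (negPf nv).
Qed.

(** Each vertex of [K] has exactly one triangular and one bare edge inside [K]. *)
Lemma plain_core_bip D K : perfect D -> K \in cores D -> {in K, forall v, plain v} ->
  bipartite_on (@adj G) K.
Proof.
move=> pD /coresP[mK dK] pK.
have nbrs v : v \in K -> exists q r, [/\ q \in K, r \in K, tri v q, bare v r &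
    forall x, x \in K -> tri v x -> x = q].
  move=> Kv; have pv := pK v Kv; have [o Do [vo nKo]] := core_owner pD dK Kv (plain_intri pv).
  have [q [vq _ _ mates]] := tri_pair (plain_nmid pv (ownxx v)) vo.
  have one x : x \in K -> tri v x -> x = q.
    by move=> Kx /mates[] // E; rewrite -E Kx in nKo.
  have [a [b [Ka Kb va vb ab]]] := mindeg2_two mK Kv.
  case: (adj_cases va) (adj_cases vb) => ta [] tb.
  - by rewrite (one a Ka ta) (one b Kb tb) eqxx in ab.
  - by exists q, b; split=> //; rewrite -(one a Ka ta).
  - by exists q, a; split=> //; rewrite -(one b Kb tb).
  - by rewrite (bare_unique (plain_intri pv) ta tb) eqxx in ab.
have /fin_all_exists[s0 s0P] : forall v, exists q, v \in K ->
    [/\ q \in K, tri v q & forall x, x \in K -> tri v x -> x = q].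
  move=> v; have [Kv|nKv] := boolP (v \in K); last by exists v.
  by have [q [r [Kq Kr vq vr one]]] := nbrs v Kv; exists q.
have /fin_all_exists[t0 t0P] : forall v, exists r, v \in K -> r \in K /\ bare v r.
  move=> v; have [Kv|nKv] := boolP (v \in K); last by exists v.
  by have [q [r [Kq Kr vq vr one]]] := nbrs v Kv; exists r.
have [||f fP] := @two_involutions G K s0 t0.
- move=> v Kv; have [Kq vq _] := s0P v Kv; have [_ _ one] := s0P _ Kq.
  by split; rewrite // 1?eq_sym ?adj_neq ?tri_adj // -(one v) // triC.
- move=> v Kv; have [Kr vr] := t0P v Kv; have [_ rr] := t0P _ Kr.
  split; rewrite // 1?eq_sym ?adj_neq ?bare_adj //.
  by apply: bare_unique rr _; [apply/plain_intri/pK | rewrite bareC].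
exists f => v w Kv Kw vw; have [fs ft] := fP v Kv; rewrite eq_sym.
case: (adj_cases vw) => t.
  by have [_ _ one] := s0P v Kv; rewrite (one w Kw t).
by have [_ b] := t0P v Kv; rewrite (bare_unique (plain_intri (pK v Kv)) t b).
Qed.

(** An end vertex of a diamond does not own the other end. *)
Lemma perfect_nplain_mid D q : perfect D -> q \in D -> ~~ plain q -> mid q.
Proof.
move=> pD Dq npq; have [m qm mm] := nplainP (perf_intri pD Dq) npq.
case/predU1P: qm => [->//|qm].
have [a [c [d [ta tc td [ac cd] [ad nad]]]]] := midP mm.
have own_ v : tri m v -> own q v := own_tri pD Dq (tri_own qm).
have mq : tri m q by rewrite triC.
have tm v : tri m v -> q != v -> tri q v by move=> /own_/predU1P[->|//]; rewrite eqxx.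
have am : a != m by rewrite eq_sym adj_neq // tri_adj.
have cm : c != m by rewrite eq_sym adj_neq // tri_adj.
have dm : d != m by rewrite eq_sym adj_neq // tri_adj.
case: (nbr3 (tri_adj ta) (tri_adj tc) (tri_adj td) (adj_neq ac) ad (adj_neq cd) (tri_adj mq)) => E.
- have [qc qd] : q != c /\ q != d by rewrite E adj_neq.
  exact: (three_tri_mid (tm c tc qc) (tm d td qd) qm (adj_neq cd) cm dm).
- have [qa qd] : q != a /\ q != d by rewrite E eq_sym !adj_neq.
  exact: (three_tri_mid (tm a ta qa) (tm d td qd) qm ad am dm).
- have [qa qc] : q != a /\ q != c by rewrite E eq_sym ad eq_sym adj_neq.
  exact: (three_tri_mid (tm a ta qa) (tm c tc qc) qm (adj_neq ac) am cm).
Qed.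

(** * Rings of diamonds *)

(** The only vertices outside [S] with a neighbour in [S] are picks in diamonds, and
    all neighbours of such a pick are in [S]. *)
Lemma nplain_core_spans D S v0 : perfect D -> S \in cores D -> v0 \in S ->
  {in S, forall v, ~~ plain v} -> forall v, v \in S \/ v \in D /\ mid v.
Proof.
move=> pD /coresP[mS dS] Sv0 npS.
have exitD v q : v \in S -> adj v q -> q \notin S -> q \in D /\ mid q.
  move=> Sv vq nSq; have [t Dq] := core_exit pD mS dS Sv vq nSq; split=> //.
  apply: (perfect_nplain_mid pD Dq); apply: contra (npS v Sv) => pq.
  by apply: plain_tri pq _; rewrite triC.
suff all : forall v, v \in S \/ [/\ v \in D, mid v & forall w, adj v w -> w \in S].
  by move=> v; case: (all v) => [|[]]; [left|right].
apply: (@connected_closed (fun v => v \in S \/ [/\ v \in D, mid v & forall w, adj v w -> w \in S]) v0).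
  by left.
move=> u w [Su|[Du mu sub]] uw; last by left; apply: sub.
have [|nSw] := boolP (w \in S); first by left.
have [Dw mw] := exitD u w Su uw nSw; right; split=> //.
have step v v' : v \in S -> adj w v' -> adj v v' -> v' \in S.
  move=> Sv wv' vv'; apply: contraT => nSv'; have [Dv' _] := exitD v v' Sv vv' nSv'.
  have E := perf_unique pD Dv' Dw (ownxx v') (tri_own (mid_adj_tri mw wv')).
  by rewrite E adj_irrefl in wv'.
have [a [c [d [ta tc td [ac cd] [ad nad]]]]] := midP mw.
have [wa wc wd] := And3 (tri_adj ta) (tri_adj tc) (tri_adj td).
have nb := nbr3 wa wc wd (adj_neq ac) ad (adj_neq cd).
have Sc : c \in S.
  have wu : adj w u by rewrite adjC.
  case: (nb u wu) => E; rewrite E in Su; first exact: step Su wc ac.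
    by [].
  by apply: step Su wc _; rewrite adjC.
by move=> v /nb[]->; [apply: step Sc wa _; rewrite adjC | | apply: step Sc wd cd].
Qed.

(** By [nplain_core_spans] every nonempty set of minimum degree 2 that avoids the
    picks contains all other vertices, so removing any one of these makes the
    rest bipartite.  If there is a diamond, with pick [y], its end [a] is removed:
    a walk of length at most 3 from [a] to a pick other than [y] uses the bare
    edge of [a], and at most one pick can be reached in this way. *)
Lemma necklace D K v0 (c : G -> 'I_3) : perfect D ->
  {in D &, forall x y, x != y -> near x y -> c x != c y} ->
  K \in cores D -> v0 \in K -> {in K, forall v, ~~ plain v} ->
  packing_colorable [tuple 1; 1; 3; 3; 3] G.
Proof.
move=> pD cP KD Kv0 npK; have span := nplain_core_spans pD KD Kv0 npK.
have [mK dK] := coresP _ _ KD.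
have midD y : y \in D -> mid y.
  by move=> Dy; case: (span y) => [/dK|[]//]; rewrite Dy.
have np v : ~~ plain v.
  by case: (span v) => [/npK|[_ mv]] //; apply: (mid_nplain mv); exact: ownxx.
have bipD a : a \notin D -> bipartite_on (@adj G) (~: (a |: D)).
  move=> nDa; apply: NNPP => /nonbip_core[S [SD nS _]].
  have [mS dS] := coresP _ _ SD.
  have [E|[v1 Sv1]] := set_0Vmem S; first by case: nS; exists xpredT => x y; rewrite E inE.
  have SD' : S \in cores D.
    by apply/coresP; split=> // v /dS; rewrite inE negb_or => /andP[].
  case: (nplain_core_spans pD SD' Sv1 (fun v _ => np v) a) => [/dS|[]].
    by rewrite !inE eqxx.
  by rewrite (negPf nDa).
have [D0|[y Dy]] := set_0Vmem D.
  (* no diamond: the graph is a cycle *)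
  apply: (@packing_from_coloring (v0 |: D) (fun=> ord0)); last by apply: bipD; rewrite D0 inE.
  by move=> u v; rewrite D0 !inE !orbF => /eqP-> /eqP->; rewrite eqxx.
have [a [b [d [ta tb td [ab bd] [ad nad]]]]] := midP (midD y Dy).
have [ya yb yd] := And3 (tri_adj ta) (tri_adj tb) (tri_adj td).
have nDa : a \notin D.
  by apply/negP=> Da; move: ya; rewrite (perf_unique pD Da Dy (ownxx a) (tri_own ta)) adj_irrefl.
have ia := tri_intri2 ta.
have nma : ~~ mid a.
  (* the middle vertices of the diamond are y and b *)
  have [b' [_ _ _ uni]] := twin (midD y Dy).
  have mb : mid b.
    have [by_ ba] : adj b y /\ adj b a by rewrite adjC yb adjC ab.
    have [tba tbd tby] : [/\ tri b a, tri b d & tri b y].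
      split; [apply: (tri3 ba by_)|apply: (tri3 bd by_)|by rewrite triC]; by rewrite adjC.
    apply: (three_tri_mid tba tbd tby ad); by rewrite eq_sym adj_neq.
  apply/negP=> ma; have := adj_neq ab.
  by rewrite (uni a ma ta) (uni b mb tb) eqxx.
have own_a z : z \in D -> own z a -> z = y.
  by move=> Dz za; apply: (perf_unique pD Dz Dy za); apply: tri_own.
have nearP z : z \in D -> z != y -> near a z -> exists s1, bare a s1 /\
    (own z s1 \/ ~~ in_triangle s1 /\ exists s2, [/\ s2 != a, adj s1 s2 & own z s2]).
  move=> Dz zy; have mz := midD z Dz.
  have last_own v : adj v z -> own z v by move=> vz; apply/tri_own/(mid_adj_tri mz); rewrite adjC.
  have nzy : own z a -> False by move/(own_a z Dz) => E; rewrite E eqxx in zy.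
  have one q : adj a q -> own z q -> exists s1, bare a s1 /\
      (own z s1 \/ ~~ in_triangle s1 /\ exists s2, [/\ s2 != a, adj s1 s2 & own z s2]).
    move=> aq zq; case: (adj_cases aq) => t; last by exists q; split=> //; left.
    by exfalso; apply: nzy; apply: (own_tri pD Dz zq); rewrite triC.
  case/or3P=> [az|/existsP[q /andP[aq qz]]|/existsP[q /existsP[q' /and3P[aq qq' q'z]]]].
  - by case: nzy; apply: last_own.
  - by apply: (one q aq); apply: last_own.
  have zq' := last_own q' q'z.
  case: (adj_cases qq') => tq; first by apply: (one q aq); apply: (own_tri pD Dz zq'); rewrite triC.
  case: (adj_cases aq) => t.
    by case: (mid_bare (diamond_end_mates (np a) nma t) tq).
  have nq'a : q' != a by apply/eqP=> E; apply: nzy; rewrite -E.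
  have [iq|nq] := boolP (in_triangle q); last by exists q; split=> //; right; split=> //; exists q'.
  by rewrite (bare_unique iq tq (_ : bare q a)) ?eqxx // bareC in nq'a.
have uniq_z z z' : z \in D -> z' \in D -> z != y -> z' != y -> near a z -> near a z' -> z = z'.
  move=> Dz Dz' zy z'y /(nearP z Dz zy)[s1 [b1 alt]] /(nearP z' Dz' z'y)[s1' [b1' alt']].
  rewrite -(bare_unique ia b1 b1') in alt'; have a1 := bare_adj b1.
  have own_i v w : v \in D -> own v w -> ~~ in_triangle w -> False.
    by move=> Dv vw; rewrite (own_intri (perf_intri pD Dv) vw).
  case: alt alt' => [zs [z's|[ns _]]|[ns [s2 [s2a s12 zs2]]] [z's|[_ [s2' [s2a' s12' zs2']]]]].
  - exact: (perf_unique pD Dz Dz' zs z's).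
  - by case: (own_i z s1).
  - by case: (own_i z' s1).
  have s1a : adj s1 a by rewrite adjC.
  have as2 : a != s2 by rewrite eq_sym.
  case: (nontri_deg2 ns s1a s12 s12' as2) => E; first by rewrite E eqxx in s2a'.
  by rewrite E in zs2'; apply: (perf_unique pD Dz Dz' zs2 zs2').
have [z0 z0P] : exists z0, forall z, z \in D -> z != y -> near a z -> z = z0.
  have [[z0 [Dz0 z0y nz0]]|no] := classic (exists z, [/\ z \in D, z != y & near a z]).
    by exists z0 => z Dz zy nz; apply: uniq_z.
  by exists y => z Dz zy nz; case: no; exists z.
have [k kN] : exists k, k \notin [set c y; c z0].
  by apply: free_color; rewrite cards2; case: (_ != _).
have {kN} [ky kz0] : k != c y /\ k != c z0.
  by move: kN; rewrite !inE negb_or => /andP[].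
apply: (@packing_from_coloring (a |: D) (fun v => if v == a then k else c v)); last exact: bipD.
have neqa v : v \in D -> (v == a) = false.
  by move=> Dv; apply: contraNF nDa => /eqP<-.
have ka v : v \in D -> near a v -> k != c v.
  by move=> Dv nv; have [->|vy] := eqVneq v y; [|rewrite (z0P v)].
move=> u v /setU1P[->|Du] /setU1P[->|Dv]; rewrite ?eqxx // ?neqa // => uv nuv.
- exact: ka.
- by rewrite eq_sym; apply: ka; rewrite // nearC.
- exact: cP.
Qed.

(** * The theorem *)

Lemma packing_noK4 : ~ isomorphic G graphH -> packing_colorable [tuple 1; 1; 3; 3; 3] G.
Proof.
move=> nH.
have [[x0 _]|empty] := classic (exists x0 : G, True); last first.
  apply: (@packing_from_coloring set0 (fun=> ord0)); first by move=> x; rewrite inE.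
  by exists xpredT => x; case: empty; exists x.
have [D [pD sD minD]] := exists_shift_minimal x0.
pose conf x y := [&& x \in D, y \in D, x != y & near x y].
have conf_sym : symmetric conf.
  by move=> x y; rewrite /conf andbCA eq_sym nearC.
have conf_irr : irreflexive conf by move=> x; rewrite /conf eqxx !andbF.
have conf_deg x : #|[set y | conf x y]| <= 3.
  have [Dx|nDx] := boolP (x \in D).
    by rewrite (eq_card (B := [set y in D | (x != y) && near x y])) ?conflict_degree //
       => y; rewrite !inE /conf Dx.
  by rewrite (eq_card0) // => y; rewrite inE /conf (negPf nDx).
have [[a [b [c [d [ab ac ad [bc bd cd]]]]]]|noK4conf] := classic (exists a b c d,
    [/\ conf a b, conf a c, conf a d & [/\ conf b c, conf b d & conf c d]]).
  pose x (i : 'I_4) := nth a [:: a; b; c; d] i.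
  have confP i j : i != j -> conf (x i) (x j).
    by case: i j => [[|[|[|[|//]]]] ?] [[|[|[|[|//]]]] ?] //= _; rewrite /x /= // conf_sym.
  have Dx i : x i \in D.
    case: (eqVneq i ord0) => [->|i0]; first by case/and4P: ab.
    by case/and4P: (confP i ord0 i0).
  have xinj : injective x.
    move=> i j E; apply/eqP; apply: contraT => /confP.
    by rewrite E conf_irr.
  have nx i j : i != j -> near (x i) (x j) by move=> /confP/and4P[].
  have [s Q] := clique_quartet pD sD Dx xinj nx.
  have [allb|] := classic (forall i j, i != j -> bare (s i j) (s j i)).
    by case: nH; apply: quartet_graphH Q allb.
  move=> nall; apply: NNPP => npc; apply: nall => i j ij; apply: contraT => nb.
  by case: npc; apply: quartet_long_link Q ij nb.
have [|c cP'] := brooks_set conf_sym conf_irr conf_deg _ [set: G].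
  by move=> a b c d ab ac ad bc bd cd; apply: noK4conf; exists a, b, c, d.
have cP : {in D &, forall x y, x != y -> near x y -> c x != c y}.
  by move=> x y Dx Dy xy nxy; apply: cP'; rewrite ?inE // /conf Dx Dy xy.
have [bD|/nonbip_core[K [KD nK mK]]] := classic (bipartite_on (@adj G) (~: D)).
  exact: (packing_from_coloring cP bD).
have [v0 Kv0] : exists v0, v0 \in K.
  have [E|[v Kv]] := set_0Vmem K; last by exists v.
  by case: nK; exists xpredT => v; rewrite E inE.
have [||E|E] := @min_nonbip_connected _ _ (@adj_sym G) K [set v in K | plain v] nK mK.
- by apply/subsetP=> v; rewrite inE => /andP[].
- move=> u w; rewrite !inE => /andP[Ku pu] Kw; rewrite Kw /= => npw.
  exact: (minD K u w KD Ku Kw pu npw).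
- apply: (necklace pD cP KD Kv0) => v Kv.
  by apply/negP=> pv; move/setP/(_ v): E; rewrite !inE Kv pv.
- case: nK; apply: (plain_core_bip pD KD) => v.
  by rewrite -E inE => /andP[].
Qed.
End Local.

Theorem theorem4 (G : sgraph) (Gconn : connected G) (Gclaw : claw_free G)
  (Gsub : subcubic G) (GnotH : ~ isomorphic G graphH) :
  packing_colorable [tuple 1; 1; 3; 3; 3] G.
Proof.
have deg3 (x : G) : #|[set y | adj x y]| <= 3.
  exact: leq_trans (leq_bigmax x) Gsub.
have clawfree (x a b c : G) : adj x a -> adj x b -> adj x c ->
    a != b -> a != c -> b != c -> [|| adj a b, adj a c | adj b c].
  move=> xa xb xc ab ac bc; apply: contraT; rewrite !negb_or => /and3P[nab nac nbc].
  case: Gclaw; exists (fun i : 'I_4 => nth x [:: x; a; b; c] i); split.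
    have u : uniq [:: x; a; b; c].
      by rewrite /= !inE !negb_or ab ac bc !adj_neq.
    by move=> i j /eqP; rewrite nth_uniq // => /eqP/val_inj.
  have [ax bx cx] : [/\ adj a x, adj b x & adj c x] by rewrite !(adjC _ x).
  have [nba nca ncb] : [/\ ~~ adj b a, ~~ adj c a & ~~ adj c b].
    by rewrite (adjC b) !(adjC c).
  by case=> [[|[|[|[|//]]]] ?] [[|[|[|[|//]]]] ?] /=;
    rewrite /K13_adj -!val_eqE /= ?adj_irrefl ?(negPf nab) ?(negPf nac) ?(negPf nbc)
      ?(negPf nba) ?(negPf nca) ?(negPf ncb).
have [[a [b [c [d [ab ac ad [bc bd cd]]]]]]|noK4] := classic (exists a b c d : G,
    [/\ adj a b, adj a c, adj a d & [/\ adj b c, adj b d & adj c d]]); last first.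
  apply: packing_noK4 => // a b c d ab ac ad bc bd cd.
  by apply: noK4; exists a, b, c, d.
(* by connectedness a copy of K4 is the whole graph *)
have all v : v \in [:: a; b; c; d].
  apply: (connected_closed Gconn (C := fun v => v \in [:: a; b; c; d]) (v0 := a)).
    by rewrite inE eqxx.
  have cl (u p q r w : G) : adj u p -> adj u q -> adj u r -> adj p q -> adj p r -> adj q r ->
      adj u w -> w \in [:: p; q; r].
    move=> up uq ur pq pr qr uw; rewrite !inE.
    by case: (nbr3 deg3 up uq ur (adj_neq pq) (adj_neq pr) (adj_neq qr) uw) => ->;
      rewrite eqxx ?orbT.
  have [ba ca da] : [/\ adj b a, adj c a & adj d a] by rewrite !(adjC _ a).
  have [cb db dc] : [/\ adj c b, adj d b & adj d c] by rewrite !(adjC _ b) (adjC d).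
  move=> u w; rewrite !inE => /or4P[]/eqP-> uw.
  - have := cl a b c d w ab ac ad bc bd cd uw.
    by rewrite !inE => /or3P[]->; rewrite ?orbT.
  - have := cl b a c d w ba bc bd ac ad cd uw.
    by rewrite !inE => /or3P[]->; rewrite ?orbT.
  - have := cl c a b d w ca cb cd ab ad bd uw.
    by rewrite !inE => /or3P[]->; rewrite ?orbT.
  - have := cl d a b c w da db dc ab ac bc uw.
    by rewrite !inE => /or3P[]->; rewrite ?orbT.
apply: (@packing_from_coloring G [set c; d] (fun v => if v == c then ord0 else ord_max)).
  move=> x y /set2P[->|->] /set2P[->|->]; rewrite ?eqxx // => h _; rewrite ?(negPf h) //.
  by rewrite (eq_sym d) (negPf h).
exists (pred1 a) => x y; rewrite !inE => /norP[xc xd] /norP[yc yd].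
have := all x; have := all y; rewrite !inE (negPf xc) (negPf xd) (negPf yc) (negPf yd) !orbF.
by case/orP=> /eqP-> /orP[]/eqP->; rewrite ?adj_irrefl //= ?eqxx ?[b == a]eq_sym (negPf (adj_neq ab)).
Qed.
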